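(* Let $k\geq 1$ be an integer. Then for all sufficiently large $n$ (depending on $k$), every graph $G\in{\rm SPEX}(n,H_{2k+3})$ is obtained from a complete bipartite graph with parts $L$ and $R$ (where $|L|+|R|=n$) by embedding into $L$ (i.e. adding edges inside $L$ forming) a graph that is $k$-regular or nearly $k$-regular and contains no $P_{2k+3}$ as a subgraph. Moreover, if $k\geq 2$ is even then $|L|=\lfloor n/2\rfloor$ or $|L|=\lceil n/2\rceil$, and if $k\geq 1$ is odd then $|L|=\frac{n}{2}$ if $n\equiv 0 \pmod 4$; $|L|=\frac{n-1}{2}$ if $n\equiv 1\pmod 4$; $|L|=\frac{n}{2}$ if $k=1$ and $n\equiv 2\pmod 4$; $|L|=\frac{n}{2}-1$ or $|L|=\frac{n}{2}+1$ if $k\geq 3$ and $n\equiv 2\pmod 4$; $|L|=\frac{n+1}{2}$ if $n\equiv 3\pmod 4$.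
   Context: All graphs are finite, simple and undirected. The spectral radius $\rho(G)$ of a graph $G$ is the largest eigenvalue of its adjacency matrix. $P_m$ denotes the path on $m$ vertices. For $\ell\geq 4$, the fan $H_\ell=K_1\vee P_\ell$ is obtained by joining a single new vertex to all vertices of $P_\ell$. For a graph $F$, ${\rm SPEX}(n,F)$ is the set of graphs of order $n$ that contain no subgraph isomorphic to $F$ and have maximum spectral radius among all such graphs. A graph is nearly $k$-regular if all its vertices have degree $k$ except one vertex which has degree $k-1$. *)

(* Defs.v *)
From HB Require Import structures.
From mathcomp Require Import all_boot all_order all_algebra.
From mathcomp Require Import all_classical reals.
From mathcomp Require complex polyrcf spectral.

Set Implicit Arguments.
Unset Strict Implicit.
Unset Printing Implicit Defensive.

Import Order.TTheory GRing.Theory Num.Theory.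
Local Open Scope ring_scope.

Record sgraph (V : finType) := SGraph {
  adj :> rel V;
  adj_sym : symmetric adj;
  adj_irr : irreflexive adj }.

(* Not necessarily induced. *)
Definition contains_subgraph (U V : finType) (F : sgraph U) (G : sgraph V) :=
  exists2 f : U -> V, injective f & forall x y, F x y -> G (f x) (f y).

Definition subgraph_free (U V : finType) (F : sgraph U) (G : sgraph V) :=
  ~ contains_subgraph F G.

Definition degree (V : finType) (G : sgraph V) (x : V) : nat :=
  #|[set y | G x y]|.

Definition regular (V : finType) (k : nat) (G : sgraph V) :=
  forall x, degree G x = k.

Definition nearly_regular (V : finType) (k : nat) (G : sgraph V) :=
  exists v, degree G v = k.-1 /\ forall x, x != v -> degree G x = k.

Section Induced.
Variables (V : finType) (G : sgraph V) (A : {set V}).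

Definition induced_rel : rel {x : V | x \in A} := fun x y => G (val x) (val y).

Lemma induced_sym : symmetric induced_rel.
Proof. by move=> x y; apply: adj_sym. Qed.

Lemma induced_irr : irreflexive induced_rel.
Proof. by move=> x; apply: adj_irr. Qed.

Definition induced := SGraph induced_sym induced_irr.
End Induced.

Section Complete.
Variable m : nat.

Definition complete_rel : rel 'I_m := fun i j => i != j.

Lemma complete_sym : symmetric complete_rel.
Proof. by move=> i j; rewrite /complete_rel eq_sym. Qed.

Lemma complete_irr : irreflexive complete_rel.
Proof. by move=> i; rewrite /complete_rel eqxx. Qed.

Definition complete_graph := SGraph complete_sym complete_irr.
End Complete.

Section Path.
Variable m : nat.

Definition path_rel : rel 'I_m :=
  fun i j => (i.+1 == j :> nat) || (j.+1 == i :> nat).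

Lemma path_sym : symmetric path_rel.
Proof. by move=> i j; rewrite /path_rel orbC. Qed.

Lemma path_irr : irreflexive path_rel.
Proof. by move=> i; rewrite /path_rel orbb gtn_eqF. Qed.

Definition path_graph := SGraph path_sym path_irr.
End Path.

Section Join.
Variables (U V : finType) (G : sgraph U) (H : sgraph V).

Definition join_rel : rel (U + V)%type := fun x y =>
  match x, y with
  | inl a, inl b => G a b
  | inr a, inr b => H a b
  | _, _ => true
  end.

Lemma join_sym : symmetric join_rel.
Proof. by case=> a [] b //=; apply: adj_sym. Qed.

Lemma join_irr : irreflexive join_rel.
Proof. by case=> a /=; apply: adj_irr. Qed.

Definition join_graph := SGraph join_sym join_irr.
End Join.

Definition fan (l : nat) := join_graph (complete_graph 1) (path_graph l).

Section SpectralRadius.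
Variables (R : realType) (n : nat).

Definition adj_mx (G : sgraph 'I_n) : 'M[R]_n := \matrix_(i, j) (G i j)%:R.

(* For n > 0 this supremum is a maximum: see spectral_radius_max. *)
Definition spectral_radius (G : sgraph 'I_n) : R :=
  sup [set a | eigenvalue (adj_mx G) a]%classic.
End SpectralRadius.

Definition SPEX (R : realType) (n : nat) (U : finType) (F : sgraph U)
    (G : sgraph 'I_n) : Prop :=
  subgraph_free F G /\
  forall G' : sgraph 'I_n, subgraph_free F G' ->
    spectral_radius R G' <= spectral_radius R G.

(* G is obtained from the complete bipartite graph with parts L and ~: L by
   embedding a graph into L; the embedded graph is then induced G L. *)
Definition bipartite_with_embedding (V : finType) (G : sgraph V) (L : {set V}) :=
  forall x y, ~~ ((x \in L) && (y \in L)) ->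
    G x y = ((x \in L) != (y \in L)).

Section SpectralRadiusMax.
Import complex polyrcf spectral.
Local Open Scope complex_scope.
Variable R : realType.

Lemma symmetric_eigenvalue_exists (n : nat) (A : 'M[R]_n) :
  (0 < n)%N -> A^T = A -> exists a, eigenvalue A a.
Proof.
case: n A => // n A _ sA.
pose AC : 'M[R[i]]_n.+1 := map_mx (real_complex R) A.
have hA : AC \is hermsymmx.
  apply: realsym_hermsym.
    by apply/is_hermitianmxP; rewrite expr0 scale1r map_mx_id // map_trmx sA.
  by apply/mxOverP => i j; rewrite mxE complex_real.
have /orthomx_spectralP AE := hermitian_normalmx hA.
have /mxOverP/(_ 0 0) := hermitian_spectral_diag_real hA.
set P := spectralmx AC in AE *; set D := spectral_diag AC in AE *.
have uP : P \in unitmx by apply: spectral_unit.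
move=> /complex_realP [a aE]; exists a.
suff : eigenvalue AC a%:C by rewrite eigenvalue_map.
apply/eigenvalueP; exists (row 0 P).
  have PA : P *m AC = diag_mx D *m P by rewrite AE !mulmxA mulmxV // mul1mx.
  by rewrite -row_mul PA row_mul row_diag_mx -scalemxAl -rowE aE.
apply/eqP => P0; have /row_freeP [B PB] : row_free P by rewrite row_free_unit.
have : row 0 (P *m B) = 0 by rewrite row_mul P0 mul0mx.
rewrite PB => /rowP /(_ 0); rewrite !mxE eqxx => /eqP.
by rewrite oner_eq0.
Qed.

Lemma spectral_radius_max (n : nat) (G : sgraph 'I_n) : (0 < n)%N ->
  eigenvalue (adj_mx R G) (spectral_radius R G) /\
  forall a, eigenvalue (adj_mx R G) a -> a <= spectral_radius R G.
Proof.
move=> n0; set A := adj_mx R G.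
have sA : A^T = A by apply/matrixP => i j; rewrite !mxE adj_sym.
have [a0 a0P] := symmetric_eigenvalue_exists n0 sA.
have evE a : eigenvalue A a = (a \in rootsR (char_poly A)).
  have cp0 : char_poly A != 0 by rewrite monic_neq0 // char_poly_monic.
  by rewrite eigenvalue_root_char -(roots_on_rootsR cp0) in_itv.
pose m := \big[Num.max/a0]_(a <- rootsR (char_poly A)) a.
have mub a : eigenvalue A a -> a <= m.
  by rewrite evE => aA; apply: le_bigmax_seq.
have mev : eigenvalue A m.
  rewrite /m big_seq; elim/big_ind: _ => //.
    by move=> x y hx hy; rewrite /Num.max; case: ifP.
  by move=> i; rewrite -evE.
suff -> : spectral_radius R G = m by [].
apply/eqP; rewrite eq_le; apply/andP; split.
  by apply: ge_sup; [exists a0 | move=> x /mub].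
by apply: ub_le_sup => //; exists m => x /mub.
Qed.
End SpectralRadiusMax.

(* Main.v *)
Require Import Defs.
From HB Require Import structures.
From mathcomp Require Import all_boot all_order all_algebra.
From mathcomp Require Import all_classical reals.
From mathcomp Require Import zify lra ring.
From mathcomp Require Import fintype finset.

(* Let r be the spectral radius of an extremal graph G and x its Perron vector,
   with x_u = 1 maximal.  As G has no fan, neighbourhoods contain no P_{2k+3}
   and so span few edges; hence r^2 x_u, which counts 2-walks from u, is at most
   O(n) + sum_{w not in N(u)} |N(w) cap N(u)| x_w.  Since r >= n/2, the cut
   (V \ N(u), N(u)) misses only O(n) edges and the weight lost by the vertices
   is O(1).  Moving a vertex to one side of the cut cannot increase r, which
   forces every weight and every degree to be nearly maximal.  In the resulting
   partition (A, B) all inner degrees are at most k, and a vertex misses at most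
   as many vertices of the other side as it has neighbours on its own side.

   Write X, Y for the total weights of A and B, and s, t for the maximal inner
   degrees.  From r X <= sum_A d_A x + |A| Y and its mirror image, and from
   r^2 - k r >= floor(n^2/4) - 1, one sees that if both sides carry edges then
   either one side has boundedly many non-isolated vertices, so that the other
   is k-regular up to O(1) vertices and contains two disjoint P_{k+1}, joined
   into a P_{2k+3} by an edge of the sparse side; or both sides have many
   disjoint edges and the fans they create force (s, t) to be (1, 1) with k = 2,
   or (1, 2) or (2, 1) with k = 3.  Then r is too small, as
   (r - s)(r - t) <= |A||B|.

   So one side, R, is empty of edges and G is complete between L and R.  Then
   |L||R| - (r^2 - k r) is the weighted sum of the deficiencies k - d_L(v), and
   comparing with explicit candidates and using parity determines the sizes.  In
   the case n = 2 mod 4 with k odd, the nearly regular candidate with |L| = n/2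
   and the regular ones with |L| = n/2 +- 1 tie to first order: they are told
   apart by whether the deficient vertex is lighter than those of R. *)

Set Implicit Arguments.
Unset Strict Implicit.
Unset Printing Implicit Defensive.

(** * Paths and fans *)

Section PathsAndFans.
Variables (V : finType) (G : sgraph V).

Lemma adjC (x y : V) : G x y = G y x.
Proof. exact: adj_sym. Qed.

Lemma adj_neq (x y : V) : G x y -> x != y.
Proof. by apply: contraTneq => ->; rewrite adj_irr. Qed.

Lemma contains_pathP (m : nat) :
  contains_subgraph (path_graph m) G <->
  exists p, [/\ size p = m, uniq p & sorted G p].
Proof.
split=> [[f injf homf]|[p [<- up sp]]].
  exists [seq f i | i <- enum 'I_m]; split.
  - by rewrite size_map size_enum_ord.
  - by rewrite map_inj_uniq // enum_uniq.
  - case: m f injf homf => [|m] f injf homf; first by rewrite enum_ord0.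
    apply/(sortedP (f ord0)) => i; rewrite size_map size_enum_ord => im.
    have im' := ltnW im; rewrite !(nth_map ord0 _ f) ?size_enum_ord //.
    by apply: homf; apply/orP; left; rewrite !nth_enum_ord.
exists (fun i => tnth (in_tuple p) i) => [i j|i j].
  have x0 : V := tnth (in_tuple p) i; rewrite !(tnth_nth x0) /= => /eqP.
  by rewrite nth_uniq // => /eqP/val_inj.
have hij (a b : 'I_(size p)) : a.+1 == b :> nat ->
    G (tnth (in_tuple p) a) (tnth (in_tuple p) b).
  move=> /eqP ab; have x0 : V := tnth (in_tuple p) a; rewrite !(tnth_nth x0) /= -ab.
  by apply/(sortedP _ sp); rewrite ab.
by move=> /= /orP[/hij//|/hij]; rewrite adjC.
Qed.

Lemma contains_fanP (l : nat) :
  contains_subgraph (fan l) G <->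
  exists c p, [/\ size p = l, uniq p, sorted G p & all (G c) p].
Proof.
split=> [[f injf homf]|[c [p [sp up gp cp]]]].
  have /contains_pathP [p' _] : contains_subgraph (path_graph l) G.
    exists (fun i => f (inr i)) => [i j /injf[]//|i j ij].
    exact: homf.
  exists (f (inl ord0)), [seq f (inr i) | i <- enum 'I_l]; split.
  - by rewrite size_map size_enum_ord.
  - by rewrite map_inj_uniq ?enum_uniq // => i j /injf [].
  - case: l f injf homf {p'} => [|l] f injf homf; first by rewrite enum_ord0.
    apply/(sortedP (f (inr ord0))) => i; rewrite size_map size_enum_ord => im.
    have im' := ltnW im; rewrite !(nth_map ord0 _ (fun i => f (inr i))) ?size_enum_ord //.
    by apply: homf; apply/orP; left; rewrite !nth_enum_ord.
  - by apply/allP => _ /mapP[i _ ->]; apply: homf.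
case: l / sp.
have gc (i : 'I_(size p)) : G c (tnth (in_tuple p) i).
  by apply/(allP cp)/mem_tnth.
exists (fun x => match x with inl _ => c | inr i => tnth (in_tuple p) i end).
  move=> [a|i] [b|j] //=; first by rewrite !ord1.
  - by move=> E; have := gc j; rewrite -E adj_irr.
  - by move=> E; have := gc i; rewrite E adj_irr.
  - have x0 : V := tnth (in_tuple p) i; rewrite !(tnth_nth x0) /= => /eqP.
    by rewrite nth_uniq // => /eqP/val_inj ->.
move=> [a|i] [b|j] //=; first by rewrite !ord1 /complete_rel eqxx.
  by move=> _; rewrite adjC.
have hij (a b : 'I_(size p)) : a.+1 == b :> nat ->
    G (tnth (in_tuple p) a) (tnth (in_tuple p) b).
  move=> /eqP ab; have x0 : V := tnth (in_tuple p) a; rewrite !(tnth_nth x0) /= -ab.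
  by apply/(sortedP _ gp); rewrite ab.
by move=> /orP[/hij//|/hij]; rewrite adjC.
Qed.

Lemma contains_fan_leq (l m : nat) : l <= m ->
  contains_subgraph (fan m) G -> contains_subgraph (fan l) G.
Proof.
move=> lm /contains_fanP [c [p [sp up gp cp]]]; apply/contains_fanP.
exists c, (take l p); split; first by rewrite size_takel ?sp.
- exact: take_uniq.
- exact: take_sorted.
- by apply/allP => x /mem_take; apply/allP.
Qed.

(** * Weaving paths together and packing short paths robustly *)

Definition deg_in (S : {set V}) (v : V) : nat := #|[set w in S | G v w]|.

(** A vertex of [s] is adjacent to the last vertex of one block and to the first vertex of the next,
    so [s] glues the [(size s).+1] blocks into one path. Recording that the path starts in a block
    lets the induction attach another vertex of [s] in front. *)
Lemma weave (s : seq V) (bs : seq (seq V)) :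
  size bs = (size s).+1 ->
  all (fun b => (0 < size b) && sorted G b) bs ->
  (forall a b, a \in s -> b \in flatten bs -> G a b) ->
  exists x q, [/\ sorted G (x :: q), perm_eq (x :: q) (s ++ flatten bs)
                & x \in flatten bs].
Proof.
elim: s bs => [|a s IH] [|b bs] //= [sbs] /andP[/andP[b0 sb] abs] H.
  case: bs sbs abs H => // _ _ _; case: b b0 sb => // x q _ sxq.
  by exists x, q; rewrite /= cats0 mem_head.
have [] := IH bs sbs abs.
  by move=> u v us vbs; apply: H; rewrite ?inE ?us ?orbT // mem_cat vbs orbT.
move=> x [q [sxq pxq xbs]]; case: b b0 sb H => // y b _ syb H.
exists y, (b ++ a :: x :: q); split.
- rewrite /= cat_path /= in syb sxq *; rewrite syb sxq andbT /=.
  rewrite adjC !H ?mem_head //; first by rewrite mem_cat xbs orbT.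
  by rewrite mem_cat mem_last.
- apply/permP => P; move/permP/(_ P): pxq.
  rewrite /= !count_cat /= count_cat; lia.
- by rewrite mem_head.
Qed.

(** A robust form of containing a path on [j] vertices: since any [z] vertices may be forbidden,
    disjoint copies can be picked one after another. *)
Definition packs (W : {set V}) (j z : nat) :=
  forall Z : {set V}, #|Z| <= z ->
  exists p, [/\ size p = j, uniq p, sorted G p & {subset p <= W :\: Z}].

Lemma packs_seq (W Z : {set V}) (j z m : nat) :
  packs W j z -> #|Z| + m * j <= z ->
  exists bs, [/\ size bs = m, all (fun b => (size b == j) && sorted G b) bs,
    uniq (flatten bs) & {subset flatten bs <= W :\: Z}].
Proof.
move=> pk; elim: m Z => [|m IH] Z Zz; first by exists [::].
have [|p [sp up gp pW]] := pk Z; first by apply: leq_trans Zz; apply: leq_addr.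
have [|bs [sbs abs ubs bsW]] := IH (Z :|: [set x in p]).
  apply: leq_trans Zz; rewrite mulSn addnA leq_add2r.
  apply: leq_trans (leq_card_setU _ _) _; rewrite leq_add2l cardsE -sp.
  exact: card_size.
exists (p :: bs); rewrite /= sbs abs sp eqxx gp; split=> //.
  rewrite cat_uniq up ubs andbT; apply/hasPn => x /bsW.
  by rewrite !inE negb_or => /andP[/andP[_]].
move=> x; rewrite mem_cat => /orP[/pW//|/bsW].
by rewrite !inE negb_or => /andP[/andP[->]].
Qed.

(** The blocks are picked among the common neighbours of [c] and [s] and woven with [s]. The
    resulting path lies in the neighbourhood of [c], which becomes the centre of the fan. *)
Lemma fan_of_packs (W : {set V}) (j z : nat) (c : V) (s : seq V) :
  0 < j -> packs W j z -> uniq s -> all (G c) s ->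
  #|[set w in W | ~~ (G c w && all (G w) s)]| + size s + (size s).+1 * j <= z ->
  contains_subgraph (fan (size s + (size s).+1 * j)) G.
Proof.
move=> j0 pk us cs Hz.
have [|bs [sbs abs ubs bsW]] :=
    packs_seq (Z := [set w in W | ~~ (G c w && all (G w) s)] :|: [set x in s])
      (m := (size s).+1) pk.
  apply: leq_trans Hz; rewrite leq_add2r.
  apply: leq_trans (leq_card_setU _ _) _; rewrite leq_add2l cardsE.
  exact: card_size.
have Hbs b : b \in flatten bs -> [/\ G c b, all (G b) s & b \notin s].
  move=> /bsW; rewrite !inE negb_or => /andP[/andP[h ->] bW].
  by move: h; rewrite bW /= negbK => /andP[-> ->].
have [] := @weave s bs sbs.
- by apply/allP => b /(allP abs) /andP[/eqP-> ->]; rewrite j0.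
- by move=> a b as_ /Hbs [_ /allP/(_ a as_)]; rewrite adjC.
move=> x [q [sxq pxq _]].
have sz : size (flatten bs) = (size s).+1 * j.
  rewrite -sbs size_flatten /shape -[in RHS](size_map size) sumnE.
  have /all_pred1P -> : all (pred1 j) (map size bs).
    by rewrite all_map; apply/allP => b /(allP abs) /andP[].
  by rewrite size_nseq big_nseq iter_addn addn0 mulnC.
apply/contains_fanP; exists c, (x :: q); split=> //.
- by rewrite (perm_size pxq) size_cat sz.
- rewrite (perm_uniq pxq) cat_uniq us ubs andbT; apply/hasPn => b.
  by case/Hbs.
- by rewrite (perm_all _ pxq) all_cat cs; apply/allP => b /Hbs [].
Qed.

Lemma packs_vertex (W : {set V}) (z : nat) : z < #|W| -> packs W 1 z.
Proof.
move=> zW Z Zz.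
have /card_gt0P [x xW] : 0 < #|W :\: Z|.
  have := subset_leq_card (subsetIr W Z); have := cardsID Z W; lia.
by exists [:: x]; split=> // y; rewrite inE => /eqP ->.
Qed.

(** From a vertex of [W] outside this set, one step inside [W] cannot enter [Z]. *)
Definition nb_closure (W Z : {set V}) : {set V} :=
  Z :|: \bigcup_(z in Z :&: W) [set v in W | G z v].

Lemma card_nb_closure (W Z : {set V}) (k : nat) :
  {in W, forall v, deg_in W v <= k} -> #|nb_closure W Z| <= k.+1 * #|Z|.
Proof.
move=> Wk; apply: leq_trans (leq_card_setU _ _) _; rewrite mulSn leq_add2l.
apply: (@leq_trans (\sum_(z in Z :&: W) deg_in W z)).
  elim/big_rec2: _ => [|z A m _ IH]; first by rewrite cards0.
  by apply: leq_trans (leq_card_setU _ _) _; rewrite leq_add2l.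
apply: (@leq_trans (\sum_(z in Z :&: W) k)).
  by apply: leq_sum => z; rewrite inE => /andP[_ /Wk].
by rewrite sum_nat_const mulnC leq_mul2l subset_leq_card ?orbT ?subsetIl.
Qed.

Lemma notin_nb_closure (W Z : {set V}) (v : V) :
  v \in W -> v \notin nb_closure W Z ->
  v \notin Z /\ forall w, w \in W -> G v w -> w \notin Z.
Proof.
move=> vW; rewrite inE negb_or => /andP[vZ /bigcupP vN]; split=> // w wW vw.
by apply/negP => wZ; apply: vN; exists w; rewrite ?inE ?wZ ?vW //= adjC.
Qed.

(** The closure of [Z] has at most [k.+1 * z] elements, so some vertex of degree at least [j] lies
    outside it and keeps all its neighbours. For [j <= 2] a star with [j] leaves is a path on [j.+1]
    vertices. *)
Lemma packs_star (W : {set V}) (k j z : nat) : 0 < j <= 2 ->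
  {in W, forall v, deg_in W v <= k} ->
  k.+1 * z < #|[set v in W | j <= deg_in W v]| -> packs W j.+1 z.
Proof.
move=> /andP[j0 j2] Wk Hz Z Zz; set Wj := [set v in W | _] in Hz.
have /card_gt0P [v] : 0 < #|Wj :\: nb_closure W Z|.
  have := subset_leq_card (subsetIr Wj (nb_closure W Z)).
  have := cardsID (nb_closure W Z) Wj; have := card_nb_closure Z Wk.
  have := leq_mul (leqnn k.+1) Zz; lia.
move=> /setDP[+ vN]; rewrite inE => /andP[vW jv].
have [vZ nvZ] := notin_nb_closure vW vN.
have vWZ : v \in W :\: Z by rewrite inE vZ vW.
case: j j0 j2 {Hz Wj} jv => [|[|[|]]] // _ _ jv.
  have /card_gt0P [w] := jv; rewrite inE => /andP[wW vw].
  exists [:: v; w]; split=> //=; rewrite ?inE ?andbT ?vw ?(adj_neq vw) //.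
  by move=> x; rewrite !inE => /orP[/eqP->|/eqP->]; rewrite ?vZ ?nvZ.
have /card_gt1P [w [w' [+ + ww']]] := jv.
rewrite !inE => /andP[wW vw] /andP[w'W vw'].
exists [:: w; v; w']; split=> //=.
- by rewrite !inE negb_or andbT eq_sym (adj_neq vw) ww' (adj_neq vw').
- by rewrite adjC vw vw'.
- by move=> x; rewrite !inE => /or3P[/eqP->|/eqP->|/eqP->]; rewrite ?vZ ?nvZ.
Qed.

(** The path starts in [W m] and grows at its head, the index dropping by one at each step. After
    [j < m] steps the head has [m] neighbours at the next index, and at most [j] of them are already
    used. *)
Lemma greedy_path (m : nat) (W : nat -> {set V}) :
  (forall i, W i.+1 \subset W i) ->
  (forall i v, v \in W i.+1 -> m <= deg_in (W i) v) ->
  0 < #|W m| ->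
  exists p, [/\ size p = m.+1, uniq p, sorted G p & {subset p <= W 0}].
Proof.
move=> Wdec Wdeg /card_gt0P [v0 v0W].
have W0 i : W i \subset W 0.
  by elim: i => // i IH; apply: subset_trans (Wdec i) IH.
suff H j : j <= m -> exists h q, [/\ size q = j, uniq (h :: q),
    sorted G (h :: q), {subset h :: q <= W 0} & h \in W (m - j)].
  by have [//|h [q [<- ? ? ? _]]] := H m; exists (h :: q).
elim: j => [_|j IH jm].
  exists v0, [::]; rewrite subn0; split=> // x; rewrite inE => /eqP ->.
  exact: (subsetP (W0 _) _ v0W).
have [|h [q [sq uq gq qW hW]]] := IH; first exact: ltnW.
have E : m - j = (m - j.+1).+1 by lia.
rewrite E in hW; pose N := [set w in W (m - j.+1) | G h w].
have mN : m <= #|N| := Wdeg _ _ hW.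
have /card_gt0P [w] : 0 < #|N :\: [set x in q]|.
  have := subset_leq_card (subsetIr N [set x in q]).
  have : #|[set x in q]| <= j by rewrite cardsE -sq card_size.
  have := cardsID [set x in q] N; lia.
rewrite !inE => /andP[wq /andP[wW hw]].
exists w, (h :: q); split=> //; first by rewrite /= sq.
- by rewrite cons_uniq uq inE negb_or eq_sym (adj_neq hw) wq.
- by rewrite /= adjC hw.
- by move=> x; rewrite inE => /orP[/eqP->|/qW//]; apply: (subsetP (W0 _) _ wW).
Qed.

(** After deleting [Z] and the vertices of degree below [k], closing up [k] times gives nested sets:
    a vertex outside the next closure has all its [k] neighbours in [W] outside the current one, so
    [greedy_path] applies. Each closure multiplies the deleted set by at most [k.+1], whence the
    power. *)
Lemma packs_path (W : {set V}) (k z : nat) :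
  {in W, forall v, deg_in W v <= k} ->
  k.+1 ^ k * (z + #|[set v in W | deg_in W v < k]|) < #|W| ->
  packs W k.+1 z.
Proof.
set low := [set v in W | _] => Wk Hz Z Zz.
pose Zi i := iter i (nb_closure W) (Z :|: low).
have cZi i : #|Zi i| <= k.+1 ^ i * (z + #|low|).
  elim: i => [|i IH].
    rewrite mul1n; apply: leq_trans (leq_card_setU _ _) _.
    by rewrite leq_add2r.
  apply: leq_trans (card_nb_closure (Zi i) Wk) _.
  by rewrite expnS -mulnA leq_mul2l IH orbT.
have Zinc i : Zi i \subset Zi i.+1 by rewrite /= subsetUl.
have lowZ i : low \subset Zi i.
  by elim: i => [|i IH]; rewrite ?subsetUr //; apply: subset_trans IH (Zinc i).
have [|||p [sp up gp pW]] := @greedy_path k (fun i => W :\: Zi i).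
- by move=> i; apply: setDS.
- move=> i v; rewrite in_setD => /andP[vZ vW].
  have [vZi nvZ] := notin_nb_closure vW vZ.
  have : v \notin low by apply: contra vZi; apply/subsetP.
  rewrite inE vW -leqNgt => /leq_trans; apply; apply: subset_leq_card.
  apply/subsetP => w; rewrite !inE => /andP[wW vw].
  by rewrite wW vw nvZ.
- have := subset_leq_card (subsetIr W (Zi k)).
  have := cardsID (Zi k) W; have := cZi k; lia.
exists p; split=> // x /pW /setDP[xW].
by rewrite /Zi /= in_setU negb_or in_setD xW => /andP[-> _].
Qed.

Lemma deg_inD1 (S : {set V}) (u v : V) : u \in S ->
  deg_in S v = G v u + deg_in (S :\ u) v.
Proof.
move=> uS; rewrite /deg_in.
have [vu|vu] := boolP (G v u).
  rewrite (cardsD1 u) inE uS vu; congr (_ + #|pred_of_set _|).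
  by apply/setP => w; rewrite !inE andbA.
rewrite add0n; apply: eq_card => w; rewrite !inE.
by case: eqVneq => //= ->; rewrite (negPf vu) andbF.
Qed.

Lemma sum_adj (S : {set V}) (v : V) : \sum_(w in S) G v w = deg_in S v.
Proof.
rewrite /deg_in -sum1_card [RHS](eq_bigl (fun w => (w \in S) && G v w)).
  by rewrite [RHS]big_mkcondr; apply: eq_bigr => w _; case: (G v w).
by move=> w; rewrite inE.
Qed.

(** A weak Erdos-Gallai bound. Deleting a vertex of degree below [l] lowers the degree sum by less
    than [2 * l]; if there is no such vertex, the greedy path has [l.+1] vertices. *)
Lemma sum_deg_path_free (S : {set V}) (l : nat) :
  (forall p, uniq p -> sorted G p -> {subset p <= S} -> size p != l) ->
  \sum_(v in S) deg_in S v <= 2 * l * #|S|.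
Proof.
have [n] := ubnP #|S|; elim: n S => // n IH S Sn free.
have [->|[v0 v0S]] := set_0Vmem S; first by rewrite big_set0.
have [/existsP[v /andP[vS vl]]|] := boolP [exists v, (v \in S) && (deg_in S v < l)].
  have := IH (S :\ v); rewrite (cardsD1 v S) vS /= in Sn *.
  move=> /(_ Sn) IHv.
  have {IHv} : \sum_(w in S :\ v) deg_in (S :\ v) w <= 2 * l * #|S :\ v|.
    apply: IHv => p up gp pS; apply: free => // x /pS.
    by rewrite !inE => /andP[].
  rewrite (big_setD1 v vS) /= => H.
  rewrite [X in _ + X <= _](eq_bigr (fun w => G v w + deg_in (S :\ v) w));
    last by move=> w wS; rewrite (deg_inD1 _ vS) adjC.
  rewrite big_split /= sum_adj.
  have := deg_inD1 v vS; rewrite adj_irr; lia.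
move=> /existsPn noS.
have [|||p [sp up gp pS]] := @greedy_path l (fun=> S).
- by [].
- by move=> _ v vS; have := noS v; rewrite vS -leqNgt.
- by apply/card_gt0P; exists v0.
have := free (take l p) (take_uniq _ up) (take_sorted _ gp).
rewrite size_takel ?sp // eqxx => H; suff : false by []; apply: H.
by move=> x /mem_take /pS.
Qed.
End PathsAndFans.

(** * Rayleigh quotients and the Perron vector *)

Section Rayleigh.
Import complex polyrcf spectral.
Import Order.TTheory GRing.Theory Num.Theory.
Local Open Scope ring_scope.
Local Open Scope complex_scope.
Local Open Scope sesquilinear_scope.
Variable R : realType.

(** Unitary diagonalisation over the complex numbers: in the coordinates [z] the form is the sum of
    the [D 0 i] times squared moduli, and each [D 0 i] is a real eigenvalue, hence at most [r]. *)
Lemma symmetric_rayleigh (n : nat) (A : 'M[R]_n) (r : R) : A^T = A ->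
  (forall a, eigenvalue A a -> a <= r) ->
  forall y : 'rV[R]_n, (y *m A *m y^T) 0 0 <= r * (y *m y^T) 0 0.
Proof.
case: n A => [|n] A sA Ar y; first by rewrite !mxE !big_ord0 mulr0.
pose AC : 'M[R[i]]_n.+1 := map_mx (real_complex R) A.
have hA : AC \is hermsymmx.
  apply: realsym_hermsym.
    by apply/is_hermitianmxP; rewrite expr0 scale1r map_mx_id // map_trmx sA.
  by apply/mxOverP => i j; rewrite mxE complex_real.
have /orthomx_spectralP AE := hermitian_normalmx hA.
have /mxOverP Dreal := hermitian_spectral_diag_real hA.
set P := spectralmx AC in AE *; set D := spectral_diag AC in AE Dreal *.
have uP : P \in unitmx by apply: spectral_unit.
have PU : P \is unitarymx by apply: spectral_unitarymx.
have Dle i : D 0 i <= r%:C.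
  have /complex_realP [a aE] := Dreal 0 i; rewrite aE lecR; apply: Ar.
  suff : eigenvalue AC a%:C by rewrite eigenvalue_map.
  apply/eigenvalueP; exists (row i P).
    have PA : P *m AC = diag_mx D *m P by rewrite AE !mulmxA mulmxV // mul1mx.
    by rewrite -row_mul PA row_mul row_diag_mx -scalemxAl -rowE aE.
  apply/eqP => P0; have /row_freeP [B PB] : row_free P by rewrite row_free_unit.
  have : row i (P *m B) = 0 by rewrite row_mul P0 mul0mx.
  rewrite PB => /rowP /(_ i); rewrite !mxE eqxx => /eqP.
  by rewrite oner_eq0.
pose yC : 'rV[R[i]]_n.+1 := map_mx (real_complex R) y.
have yCt : yC^T = yC ^t*.
  by apply/matrixP => i j; rewrite !mxE conj_Creal // complex_real.
pose z := yC *m P ^t*.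
have zt : z ^t* = P *m yC^T.
  by rewrite /z trmx_mul map_mxM /= trmxCK -yCt.
have E1 : ((y *m A *m y^T) 0 0)%:C = \sum_i D 0 i * (z 0 i * (z 0 i)^*).
  have -> : ((y *m A *m y^T) 0 0)%:C = (yC *m AC *m yC^T) 0 0.
    by rewrite /yC map_trmx -!map_mxM [RHS]mxE.
  have -> : yC *m AC *m yC^T = z *m diag_mx D *m z ^t*.
    by rewrite zt AE invmx_unitary // /z !mulmxA.
  rewrite mxE; apply: eq_bigr => i _; rewrite mul_mx_diag !mxE.
  by rewrite mulrA [D 0 i * _]mulrC.
have E2 : ((y *m y^T) 0 0)%:C = \sum_i z 0 i * (z 0 i)^*.
  have -> : ((y *m y^T) 0 0)%:C = (yC *m yC^T) 0 0.
    by rewrite /yC map_trmx -!map_mxM [RHS]mxE.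
  have -> : yC *m yC^T = z *m z ^t*.
    by rewrite zt /z !mulmxA mulmxKtV.
  by rewrite mxE; apply: eq_bigr => i _; rewrite !mxE.
rewrite -lecR rmorphM /= E1 E2 mulr_sumr; apply: ler_sum => i _.
by apply: ler_wpM2r (Dle i); apply: mul_conjC_ge0.
Qed.

End Rayleigh.

Section Perron.
Import Order.TTheory GRing.Theory Num.Theory.
Local Open Scope ring_scope.
Variable R : realType.

Definition nsum (V : finType) (G : sgraph V) (x : V -> R) (v : V) : R :=
  \sum_(w | G v w) x w.

Variable n : nat.
Implicit Types (G : sgraph 'I_n) (y : 'I_n -> R).

Lemma adj_mx_sym G : (adj_mx R G)^T = adj_mx R G.
Proof. by apply/matrixP => i j; rewrite !mxE adj_sym. Qed.

Lemma mul_adj_mx G y v : ((\row_i y i) *m adj_mx R G) 0 v = nsum G y v.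
Proof.
rewrite mxE /nsum [RHS]big_mkcond; apply: eq_bigr => w _.
by rewrite !mxE adj_sym; case: (G v w); rewrite ?mulr1 ?mulr0.
Qed.

Lemma rayleigh G y :
  \sum_v y v * nsum G y v <= spectral_radius R G * \sum_v y v ^+ 2.
Proof.
have [n0|n0] := posnP n.
  by rewrite !big1 ?mulr0 // => i; have := ltn_ord i; rewrite {2}n0.
have [_ mx] := spectral_radius_max R G n0.
have := symmetric_rayleigh (adj_mx_sym G) mx (\row_i y i).
rewrite !mxE (eq_bigr (fun v => y v * nsum G y v)); last first.
  by move=> v _; rewrite mul_adj_mx !mxE mulrC.
by rewrite [X in _ * X](eq_bigr (fun v => y v ^+ 2)) // => v _; rewrite !mxE.
Qed.

Lemma nsumD (V : finType) (H : sgraph V) (x z : V -> R) v :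
  nsum H (fun w => x w + z w) v = nsum H x v + nsum H z v.
Proof. exact: big_split. Qed.

Lemma sum_delta (y : 'I_n -> R) (v : 'I_n) (t : R) :
  \sum_w y w * (t *+ (w == v)) = y v * t.
Proof.
rewrite (bigD1 v) //= eqxx big1 ?addr0 // => w /negPf ->.
by rewrite mulr0n mulr0.
Qed.

Lemma nsum_delta G (v : 'I_n) (t : R) (w : 'I_n) :
  nsum G (fun u => t *+ (u == v)) w = t *+ G w v.
Proof.
rewrite /nsum big_mkcond (bigD1 v) //= eqxx big1 ?addr0.
  by case: (G w v).
by move=> u /negPf ->; case: (G w u).
Qed.

(** The equality case. Perturbing the coordinate at [v] by [t] keeps the Rayleigh inequality, which
    becomes a quadratic in [t] without constant term; its linear coefficient must vanish. *)
Lemma rayleigh_eq G y :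
  spectral_radius R G * \sum_v y v ^+ 2 <= \sum_v y v * nsum G y v ->
  forall v, nsum G y v = spectral_radius R G * y v.
Proof.
set r := spectral_radius R G => hy v.
pose c := r * y v - nsum G y v.
have quad t : 0 <= t * c *+ 2 + r * t ^+ 2.
  have := rayleigh G (fun w => y w + t *+ (w == v)); rewrite -/r.
  rewrite (eq_bigr (fun w => (y w * nsum G y w + y w * (t *+ G w v)) +
     (nsum G y w * (t *+ (w == v)) + (t *+ G w v) * (t *+ (w == v))))); last first.
    by move=> w _; rewrite nsumD nsum_delta; ring.
  rewrite [X in _ <= r * X](eq_bigr (fun w => y w ^+ 2 +
     ((y w *+ 2) * (t *+ (w == v)) + (t *+ (w == v)) * (t *+ (w == v))))); last first.
    by move=> w _; ring.
  rewrite !big_split /= !sum_delta eqxx adj_irr mulr0n mul0r addr0.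
  have -> : \sum_w y w * (t *+ G w v) = t * nsum G y v.
    rewrite /nsum mulr_sumr [RHS]big_mkcond; apply: eq_bigr => w _.
    by rewrite adj_sym; case: (G v w); rewrite ?mulr1n ?mulr0n ?mulr0 // mulrC.
  move: hy; rewrite -/r /c; set S1 := \sum_w y w * _; set S2 := \sum_w y w ^+ 2.
  by rewrite !mulr2n !mulr1n; lra.
suff c0 : c = 0 by apply/eqP; rewrite eq_sym -subr_eq0 -/c c0.
apply/eqP; apply: contraT => cn0.
have c2 : 0 < c ^+ 2 by rewrite exprn_even_gt0.
(* With [t = - (s * c)] the quadratic equals [s * c ^+ 2 * (r * s - 2)], negative once
   [r * s <= 1]. *)
pose s := (`|r| + 1)^-1.
have s0 : 0 < s by rewrite invr_gt0 ltr_wpDl.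
have rs : r * s <= 1.
  rewrite -(ler_pM2r (x := `|r| + 1)) ?ltr_wpDl // mulfVK ?gt_eqF ?ltr_wpDl //.
  by rewrite mul1r ler_wpDr // ler_norm.
have := quad (- (s * c)); rewrite mulr2n.
have -> : - (s * c) * c + - (s * c) * c + r * (- (s * c)) ^+ 2 =
   (s * c ^+ 2) * (r * s - 2) by ring.
rewrite (pmulr_rge0 _ (mulr_gt0 s0 c2)) => H; exfalso; lra.
Qed.

(** Taking absolute values in an eigenvector for the spectral radius does not decrease the quadratic
    form, so by [rayleigh_eq] they again form an eigenvector; it is then scaled to have maximum
    1. *)
Lemma perron G : (0 < n)%N -> exists x : 'I_n -> R,
  [/\ forall v, 0 <= x v <= 1, exists u, x u = 1
    & forall v, nsum G x v = spectral_radius R G * x v].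
Proof.
move=> n0; have [/eigenvalueP [z zE zn0] _] := spectral_radius_max R G n0.
set r := spectral_radius R G in zE *.
have {}zE v : nsum G (z 0) v = r * z 0 v.
  rewrite -mul_adj_mx; have -> : \row_i z 0 i = z by apply/rowP => i; rewrite mxE.
  by rewrite zE mxE.
pose y v := `|z 0 v|.
have yE : forall v, nsum G y v = r * y v.
  apply: rayleigh_eq; rewrite -/r.
  have -> : r * \sum_v y v ^+ 2 = \sum_v z 0 v * nsum G (z 0) v.
    rewrite mulr_sumr; apply: eq_bigr => v _.
    by rewrite zE /y real_normK ?num_real //; ring.
  apply: ler_sum => v _; apply: le_trans (ler_norm _) _.
  by rewrite normrM ler_wpM2l // /nsum ler_norm_sum.
pose u := [arg max_(i > Ordinal n0) y i]%O.
have yu v : y v <= y u by rewrite /u; case: arg_maxP => // i _; apply.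
have yu0 : 0 < y u.
  rewrite lt_neqAle normr_ge0 andbT eq_sym; apply: contra zn0 => /eqP yu0.
  apply/eqP/rowP => i; rewrite mxE; apply/eqP; rewrite -normr_eq0 eq_le.
  by rewrite normr_ge0 andbT; have := yu i; rewrite yu0.
exists (fun v => y v / y u); split.
- by move=> v; rewrite divr_ge0 ?normr_ge0 //= ler_pdivrMr // mul1r.
- by exists u; rewrite divff ?gt_eqF.
- by move=> v; rewrite /nsum -mulr_suml mulrA -yE.
Qed.

End Perron.

(** * Extremal candidates *)

Section DisjointUnion.
Variables (T1 T2 : finType) (G1 : sgraph T1) (G2 : sgraph T2).

Definition union_rel : rel (T1 + T2)%type := fun x y =>
  match x, y with
  | inl a, inl b => G1 a b
  | inr a, inr b => G2 a b
  | _, _ => false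
  end.

Lemma union_sym : symmetric union_rel.
Proof. by case=> a [] b //=; apply: adj_sym. Qed.

Lemma union_irr : irreflexive union_rel.
Proof. by case=> a /=; apply: adj_irr. Qed.

Definition union_graph := SGraph union_sym union_irr.

Lemma degree_unionl (x : T1) : degree union_graph (inl x) = degree G1 x.
Proof.
rewrite /degree -(card_imset _ (@inl_inj T1 T2)); apply: eq_card => y.
rewrite inE; apply/idP/imsetP => [|[z]]; last by rewrite inE => xz ->.
by case: y => // y xy; exists y; rewrite ?inE.
Qed.

Lemma degree_unionr (x : T2) : degree union_graph (inr x) = degree G2 x.
Proof.
rewrite /degree -(card_imset _ (@inr_inj T1 T2)); apply: eq_card => y.
rewrite inE; apply/idP/imsetP => [|[z]]; last by rewrite inE => xz ->.
by case: y => // y xy; exists y; rewrite ?inE.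
Qed.

Lemma path_unionl (x : T1) (p : seq (T1 + T2)%type) :
  path union_graph (inl x) p -> exists2 q, p = map inl q & path G1 x q.
Proof.
elim: p x => [|[y|y] p IH] x //=; first by exists [::].
by move=> /andP[xy /IH [q -> yq]]; exists (y :: q); rewrite //= xy.
Qed.

Lemma path_unionr (x : T2) (p : seq (T1 + T2)%type) :
  path union_graph (inr x) p -> exists2 q, p = map inr q & path G2 x q.
Proof.
elim: p x => [|[y|y] p IH] x //=; first by exists [::].
by move=> /andP[xy /IH [q -> yq]]; exists (y :: q); rewrite //= xy.
Qed.
End DisjointUnion.

Definition path_bounded (V : finType) (G : sgraph V) (m : nat) :=
  forall p, uniq p -> sorted G p -> size p <= m.

Lemma path_bounded_union (T1 T2 : finType) (G1 : sgraph T1) (G2 : sgraph T2)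
    (m : nat) :
  path_bounded G1 m -> path_bounded G2 m -> path_bounded (union_graph G1 G2) m.
Proof.
move=> H1 H2 [|[x|x] p] // up sp.
  have [q pq xq] := path_unionl sp; rewrite {}pq in up *.
  rewrite -map_cons size_map; apply: H1 => //.
  by move: up; rewrite -map_cons map_inj_uniq //; apply: inl_inj.
have [q pq xq] := path_unionr sp; rewrite {}pq in up *.
rewrite -map_cons size_map; apply: H2 => //.
by move: up; rewrite -map_cons map_inj_uniq //; apply: inr_inj.
Qed.

Lemma path_bounded_card (V : finType) (G : sgraph V) : path_bounded G #|V|.
Proof. by move=> p up _; rewrite -(card_uniqP up) max_card. Qed.

Section CompleteBipartite.
Variable k : nat.

Definition biclique_rel : rel (bool * 'I_k) := fun x y => x.1 != y.1.

Lemma biclique_sym : symmetric biclique_rel.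
Proof. by move=> x y; rewrite /biclique_rel eq_sym. Qed.

Lemma biclique_irr : irreflexive biclique_rel.
Proof. by move=> x; rewrite /biclique_rel eqxx. Qed.

Definition biclique := SGraph biclique_sym biclique_irr.

Lemma degree_biclique x : degree biclique x = k.
Proof.
rewrite /degree -[RHS]card_ord -(card_imset _ (f := fun i : 'I_k => (~~ x.1, i))).
  apply: eq_card => -[b i]; rewrite inE /= /biclique_rel /=.
  apply/idP/imsetP => [xb|[j _ [-> _]]]; last by case: (x.1).
  by exists i => //; congr (_, _); case: (x.1) b xb => -[].
by move=> i j [].
Qed.
End CompleteBipartite.

Lemma degree_complete m (x : 'I_m) : degree (complete_graph m) x = m.-1.
Proof.
rewrite /degree -[m in RHS]card_ord -(cardsC1 x); apply: eq_card => y.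
by rewrite !inE /= /complete_rel eq_sym.
Qed.

Definition regular_path_bounded (k m a : nat) :=
  exists (T : finType) (H : sgraph T),
    [/\ #|T| = a, regular k H & path_bounded H m].

Lemma regular_path_boundedD (k m a b : nat) :
  regular_path_bounded k m a -> regular_path_bounded k m b ->
  regular_path_bounded k m (a + b).
Proof.
move=> [T1 [H1 [c1 r1 p1]]] [T2 [H2 [c2 r2 p2]]].
exists (T1 + T2)%type, (union_graph H1 H2); split.
- by rewrite card_sum c1 c2.
- by case=> x; rewrite ?degree_unionl ?degree_unionr.
- exact: path_bounded_union.
Qed.

Lemma regular_path_boundedM (k m a p : nat) :
  regular_path_bounded k m a -> regular_path_bounded k m (p * a).
Proof.
move=> Ha; elim: p => [|p IH]; last exact: regular_path_boundedD.
exists 'I_0, (complete_graph 0); split; rewrite ?card_ord //; first by case.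
by case=> // -[].
Qed.

(** The coins are the orders of the clique on [k.+1] vertices and of the biclique on [2 * k]
    vertices. As [2k = 2(k+1) - 2], trading two cliques for a biclique lowers the total by 2. *)
Lemma two_coin (k a : nat) : 2 * k * k.+1 <= a -> ~~ odd (k * a) ->
  exists p q, a = p * k.+1 + q * (2 * k).
Proof.
move=> ak ev; have aE := divn_eq a k.+1; have := ltn_pmod a (ltn0Sn k).
move: (a %/ k.+1) (a %% k.+1) aE => d r aE rk.
(* Trading [q] times reaches the remainder [r] as soon as [r + 2 * q] is a multiple of [k.+1]; the
   parities of [k] and [r] decide which multiple is possible. *)
have [q [e [qk re]]] : exists q e, q <= k /\ r + 2 * q = e * k.+1.
  have [ok|ek] := boolP (odd k).
    have er : ~~ odd r.
      by move: ev; rewrite aE oddM ok /= oddD oddM /= ok andbF.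
    by exists ((k.+1 - r) %/ 2), 1; lia.
  have [or|er] := boolP (odd r).
    by exists ((k.+1 - r) %/ 2), 1; lia.
  have [r0|r0] := posnP r; first by exists 0, 0; lia.
  by exists ((2 * k.+1 - r) %/ 2), 2; lia.
exists (d + e - 2 * q), q.
(* The lower bound on [a] provides the [2 * q <= 2 * k] cliques to be traded away. *)
have dk : 2 * k <= d.
  by rewrite leqNgt; apply/negP => h; have := leq_mul h (leqnn k.+1); lia.
suff : d * k.+1 + r + 2 * q * k.+1 = (d + e) * k.+1 + q * (2 * k).
  have : 2 * q * k.+1 <= (d + e) * k.+1 by rewrite leq_pmul2r; lia.
  by rewrite -aE mulnBl => ? ?; lia.
by rewrite mulnDl -re; lia.
Qed.

(** Paths stay inside the components, which are cliques and bicliques with fewer than [2 * k + 2]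
    vertices. *)
Lemma regular_path_bounded_exists (k a : nat) : 0 < k ->
  2 * k * k.+1 <= a -> ~~ odd (k * a) -> regular_path_bounded k (2 * k + 2) a.
Proof.
move=> k0 ak ev; have [p [q ->]] := two_coin ak ev.
apply: regular_path_boundedD; apply: regular_path_boundedM.
  exists 'I_k.+1, (complete_graph k.+1); rewrite card_ord; split=> //.
    by move=> x; rewrite degree_complete.
  move=> s us ss; apply: leq_trans (path_bounded_card us ss) _.
  by rewrite card_ord; lia.
exists (bool * 'I_k)%type, (biclique k); split.
- by rewrite card_prod card_bool card_ord.
- exact: degree_biclique.
move=> s us ss; apply: leq_trans (path_bounded_card us ss) _.
by rewrite card_prod card_bool card_ord; lia.
Qed.

Lemma transport_graph (T : finType) (J : sgraph T) (n : nat) : #|T| = n ->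
  exists (G : sgraph 'I_n) (f : 'I_n -> T),
    bijective f /\ forall i j, G i j = J (f i) (f j).
Proof.
move=> <-.
have fsym : symmetric (fun i j : 'I_#|T| => J (enum_val i) (enum_val j)).
  by move=> i j; apply: adj_sym.
have firr : irreflexive (fun i j : 'I_#|T| => J (enum_val i) (enum_val j)).
  by move=> i; apply: adj_irr.
by exists (SGraph fsym firr), enum_val; split=> //; apply: enum_val_bij.
Qed.

(* Splitting the path into consecutive pairs: each pair has a vertex in [A]. *)
Lemma count_cover_path (V : eqType) (e : rel V) (A : pred V) (m : nat)
    (p : seq V) :
  (forall x y, e x y -> A x || A y) -> sorted e p -> 2 * m <= size p ->
  m <= count A p.
Proof.
move=> eA; elim: m p => [|m IH] [|x [|y p]] //=.
  by move=> _ H; exfalso; move: H; clear; lia.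
move=> /andP[/eA Axy yp] mp.
have : m <= count A p by apply: IH; [apply: path_sorted yp|lia].
by move: Axy; case: (A x); case: (A y) => //=; lia.
Qed.

(** If the centre is outside [L], the rim lies in [L] and is too long. If it is inside, every edge
    of the rim meets [L], so at least [k.+1] rim vertices are neighbours of the centre in [L]. *)
Lemma embedding_fan_free (V : finType) (G : sgraph V) (L : {set V}) (k : nat) :
  bipartite_with_embedding G L ->
  {in L, forall v, deg_in G L v <= k} ->
  (forall p, uniq p -> sorted G p -> {subset p <= L} -> size p <= 2 * k + 2) ->
  subgraph_free (fan (2 * k + 3)) G.
Proof.
move=> bip Lk Lp /contains_fanP [c [p [sp up gp /allP cp]]].
have [cL|cL] := boolP (c \in L); last first.
  have := Lp p up gp; rewrite sp => H; suff : 2 * k + 3 <= 2 * k + 2 by lia.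
  apply: H => x /cp; rewrite bip ?(negPf cL) //.
  by case: (x \in L).
have cov (x y : V) : G x y -> (x \in L) || (y \in L).
  by case: (boolP (x \in L)) => //= xL; rewrite bip ?(negPf xL) //; case: (y \in L).
have := count_cover_path (m := k.+1) cov gp.
rewrite sp => /(_ _) H; have {H} : k.+1 <= count (mem L) p by apply: H; lia.
rewrite -size_filter ltnNge => /negP; apply.
rewrite -(card_uniqP (filter_uniq _ up)); apply: leq_trans (Lk c cL).
rewrite /deg_in; apply/subset_leq_card/subsetP => x.
rewrite mem_filter inE => /andP[xL /cp ->]; rewrite andbT; exact: xL.
Qed.

Definition empty_graph (b : nat) : sgraph 'I_b.
Proof. by refine (@SGraph _ (fun _ _ => false) _ _). Defined.

(** The graph is the join of [H] with [b] isolated vertices, relabelled by ordinals; [g] records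
    where the vertices of [H] go. *)
Lemma candidate (T : finType) (H : sgraph T) (k a b : nat) :
  #|T| = a -> (forall t, degree H t <= k) -> path_bounded H (2 * k + 2) ->
  exists (G : sgraph 'I_(a + b)) (L : {set 'I_(a + b)}) (g : T -> 'I_(a + b)),
  [/\ subgraph_free (fan (2 * k + 3)) G, bipartite_with_embedding G L, #|L| = a
    & injective g /\ L = g @: T /\ forall t, deg_in G L (g t) = degree H t].
Proof.
move=> cT Hk Hp.
have [|G [f [[h fh hf] Gf]]] :=
    @transport_graph _ (join_graph H (empty_graph b)) (a + b).
  by rewrite card_sum cT card_ord.
pose g t := h (inl t).
have ginj : injective g by move=> s t /(can_inj hf) [].
have inL v : (v \in g @: T) = (if f v is inl _ then true else false).
  apply/imsetP/idP => [[t _ ->]|]; first by rewrite /g hf.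
  by case fv: (f v) => [t|//] _; exists t; rewrite // /g -fv fh.
have Gg s t : G (g s) (g t) = H s t by rewrite Gf /g !hf.
have degL t : deg_in G (g @: T) (g t) = degree H t.
  rewrite /degree -(card_imset _ ginj); apply: eq_card => v.
  rewrite inE; apply/andP/imsetP => [[/imsetP[s _ ->]]|[s + ->]].
    by rewrite Gg => ts; exists s; rewrite ?inE.
  by rewrite inE Gg imset_f.
have bip : bipartite_with_embedding G (g @: T).
  by move=> x y; rewrite Gf !inL; case: (f x) => s; case: (f y) => t.
exists G, (g @: T), g; split=> //; last by rewrite card_imset.
apply: (embedding_fan_free bip) => [v /imsetP[t _ ->]|]; first by rewrite degL.
move=> p up sp pL.
have pE : p = map g (pmap (fun v => if f v is inl t then Some t else None) p).
  elim: p pL {up sp} => //= v p IH pL.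
  have := pL v (mem_head _ _); rewrite inL; case fv: (f v) => [t|//] _ /=.
  rewrite -IH; last by move=> w wp; apply: pL; rewrite inE wp orbT.
  by rewrite /g -fv fh.
rewrite pE size_map; apply: Hp; first by rewrite -(map_inj_uniq ginj) -pE.
move: sp; rewrite {1}pE sorted_map; apply: sub_sorted => s t /=.
by rewrite Gg.
Qed.

(** * Weights in a complete bipartite graph with an embedding *)

Section EigenSums.
Import Order.TTheory GRing.Theory Num.Theory.
Local Open Scope ring_scope.
Variables (R : realType) (V : finType) (G : sgraph V) (x : V -> R) (r : R).
Hypothesis eig : forall v, nsum G x v = r * x v.

Lemma sum_nbrs (A B : {set V}) :
  \sum_(v in A) \sum_(w in B | G v w) x w = \sum_(w in B) (deg_in G A w)%:R * x w.
Proof.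
under eq_bigr do rewrite big_mkcondr /=.
rewrite exchange_big; apply: eq_bigr => w _ /=.
rewrite -sum_adj natr_sum mulr_suml; apply: eq_bigr => v _.
by rewrite adj_sym; case: (G w v); rewrite ?mul1r ?mul0r.
Qed.

Lemma eig_sum (A : {set V}) : r * \sum_(v in A) x v =
  \sum_(w in A) (deg_in G A w)%:R * x w
  + \sum_(w in ~: A) (deg_in G A w)%:R * x w.
Proof.
rewrite mulr_sumr -(sum_nbrs A A) -(sum_nbrs A (~: A)) -big_split /=.
apply: eq_bigr => v _; rewrite -eig /nsum (bigID (mem A)) /=; congr (_ + _).
  by apply: eq_bigl => w; rewrite andbC.
by apply: eq_bigl => w; rewrite inE andbC.
Qed.

Section Embedding.
Variables (L : {set V}) (k : nat).
Hypothesis bip : bipartite_with_embedding G L.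

Lemma deg_in_crossL (w : V) : w \notin L -> deg_in G L w = #|L|.
Proof.
move=> wL; apply: eq_card => v; rewrite inE bip ?(negPf wL) //.
by case: (v \in L).
Qed.

Lemma embedding_value (w : V) : w \notin L -> r * x w = \sum_(v in L) x v.
Proof.
move=> wL; rewrite -eig; apply: eq_bigl => v; rewrite bip ?(negPf wL) //.
by case: (v \in L).
Qed.

Lemma embedding_sumR : r * \sum_(w in ~: L) x w = #|~: L|%:R * \sum_(v in L) x v.
Proof.
rewrite mulr_sumr (eq_bigr (fun=> \sum_(v in L) x v)); last first.
  by move=> w; rewrite inE => /embedding_value.
by rewrite sumr_const mulr_natl.
Qed.

Lemma embedding_sumL : r * \sum_(v in L) x v =
  \sum_(v in L) (deg_in G L v)%:R * x v + #|L|%:R * \sum_(w in ~: L) x w.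
Proof.
rewrite eig_sum; congr (_ + _); rewrite mulr_sumr; apply: eq_bigr => w.
by rewrite inE => /deg_in_crossL ->.
Qed.

(** Eliminate the total weight of the complement of [L] from [embedding_sumL] and [embedding_sumR].
    The right-hand side is the weighted deficiency of the embedded graph from [k]-regularity, so
    this ties [r] to the part sizes. *)
Lemma embedding_identity :
  (r ^+ 2 - k%:R * r - #|L|%:R * #|~: L|%:R) * \sum_(v in L) x v
  = - (r * \sum_(v in L) (k%:R - (deg_in G L v)%:R) * x v).
Proof.
have := embedding_sumR; have := embedding_sumL.
rewrite (eq_bigr (fun v => k%:R * x v - (deg_in G L v)%:R * x v)
   (F1 := fun v => (k%:R - _) * x v)); last by move=> v _; ring.
rewrite big_split /= sumrN -mulr_sumr.
set X := \sum_(v in L) x v; set Y := \sum_(w in ~: L) x w.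
set D := \sum_(v in L) _ * _ => E1 E2.
have -> : D = r * X - #|L|%:R * Y by rewrite E1; ring.
transitivity (r * (r * X) - k%:R * r * X - #|L|%:R * (#|~: L|%:R * X)); first by ring.
by rewrite -E2; ring.
Qed.

(** A zero sum forces [x] to vanish on [L], and then outside [L] by [embedding_value], against the
    maximum 1. *)
Lemma embedding_sum_gt0 : (forall v, 0 <= x v) -> (exists u, x u = 1) ->
  (0 < #|L|)%N -> 0 < r -> 0 < \sum_(v in L) x v.
Proof.
move=> x0 [u xu] /card_gt0P [v vL] r0.
have sge0 : 0 <= \sum_(v in L) x v by apply: sumr_ge0.
rewrite lt_neqAle sge0 andbT eq_sym; apply/negP => /eqP s0.
have xL w : w \in L -> x w = 0.
  by move=> wL; apply: (psumr_eq0P _ s0) => // i _; apply: x0.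
have [/xL|/embedding_value] := boolP (u \in L).
  by rewrite xu => /eqP; rewrite oner_eq0.
by rewrite s0 xu mulr1 => r00; rewrite r00 ltxx in r0.
Qed.
End Embedding.
End EigenSums.

(** * Spectral radii of the candidates *)

Section LowerBounds.
Import Order.TTheory GRing.Theory Num.Theory.
Local Open Scope ring_scope.
Variable R : realType.

Lemma spectral_radius_gt0 (n : nat) (G : sgraph 'I_n) (u v : 'I_n) :
  G u v -> 0 < spectral_radius R G.
Proof.
move=> uv; have := rayleigh G (fun w => (w == u)%:R + (w == v)%:R : R).
set r := spectral_radius R G; set S := \sum_v _ ^+ 2 => H.
have : 0 < r * S.
  apply: lt_le_trans H; rewrite (bigD1 u) //= eqxx.
  apply: ltr_pwDl; last first.
    apply: sumr_ge0 => w _; apply: mulr_ge0; first exact: addr_ge0.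
    by apply: sumr_ge0 => z _; apply: addr_ge0.
  apply: mulr_gt0; first by apply: ltr_pwDl.
  rewrite /nsum (bigD1 v) //= eqxx; apply: ltr_pwDl.
    by apply: ltr_wpDl.
  by apply: sumr_ge0 => z _; apply: addr_ge0.
move=> H'; rewrite ltNge; apply/negP => r0; move: H'; rewrite ltNge => /negP; apply.
by apply: mulr_le0_ge0 => //; apply: sumr_ge0 => w _; apply: sqr_ge0.
Qed.

Lemma card_setC_add (a b : nat) (L : {set 'I_(a + b)}) : #|L| = a -> #|~: L| = b.
Proof. by have := cardsC L; rewrite card_ord; lia. Qed.

(** For a [k]-regular embedded graph the deficiency is zero, and [embedding_identity] gives the
    exact value. *)
Lemma spex_lower_regular (k a b : nat) : (0 < k)%N -> (0 < b)%N ->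
  (2 * k * k.+1 < a)%N -> ~~ odd (k * a) ->
  exists G : sgraph 'I_(a + b), [/\ subgraph_free (fan (2 * k + 3)) G,
    0 < spectral_radius R G
  & spectral_radius R G ^+ 2 - k%:R * spectral_radius R G = a%:R * b%:R].
Proof.
move=> k0 b0 ak ev.
have [T [H [cT rH pH]]] := regular_path_bounded_exists k0 (ltnW ak) ev.
have [|G [L [g [ffree bip cL [ginj [LE degL]]]]]] := candidate b cT _ pH.
  by move=> t; rewrite rH.
have cR := card_setC_add cL.
have /card_gt0P [u uL] : (0 < #|L|)%N by rewrite cL; lia.
have /card_gt0P [v vL] : (0 < #|~: L|)%N by rewrite cR.
have uv : G u v.
  by move: vL; rewrite inE => vL; rewrite bip uL ?(negPf vL).
exists G; have r0 := spectral_radius_gt0 uv; split=> //.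
have [|x [x01 xu eig]] := perron R G; first by lia.
have x0 w : 0 <= x w by case/andP: (x01 w).
have X0 := embedding_sum_gt0 eig bip x0 xu _ r0.
have := embedding_identity eig k bip.
rewrite [X in _ = - (_ * X)]big1; last first.
  by move=> w; rewrite LE => /imsetP[t _ ->]; rewrite -LE degL rH subrr mul0r.
rewrite mulr0 oppr0 cL cR => /eqP; rewrite mulf_eq0 [X in _ || X]gt_eqF ?orbF.
  by rewrite subr_eq0 => /eqP.
by apply: X0; rewrite cL; lia.
Qed.

(** The embedded graph is a matching that leaves one vertex [v0] isolated, so the deficiency is
    [x v0]. Eliminating the weights gives [r^2 - r = a^2 - a / r], which exceeds [a^2 - 1] because
    [r > a]. *)
Lemma spex_lower_matching (a : nat) : (4 < a)%N -> odd a ->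
  exists G : sgraph 'I_(a + a), [/\ subgraph_free (fan (2 * 1 + 3)) G,
    0 < spectral_radius R G
  & a%:R ^+ 2 - 1 < spectral_radius R G ^+ 2 - spectral_radius R G].
Proof.
move=> a4 oa.
have [||T [H [cT rH pH]]] := @regular_path_bounded_exists 1 a.-1 isT.
- by lia.
- by lia.
have [|t||G [L [g [ffree bip cL [ginj [LE degL]]]]]] :=
    @candidate (T + 'I_1)%type (union_graph H (complete_graph 1)) 1 a a.
- by rewrite card_sum cT card_ord; lia.
- by case: t => t; rewrite ?degree_unionl ?degree_unionr ?rH ?degree_complete.
- apply: path_bounded_union => //.
  move=> s us ss; apply: leq_trans (path_bounded_card us ss) _.
  by rewrite card_ord.
have cR := card_setC_add cL.
have /card_gt0P [u uL] : (0 < #|L|)%N by rewrite cL; lia.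
have /card_gt0P [v vL] : (0 < #|~: L|)%N by rewrite cR; lia.
have uv : G u v.
  by move: vL; rewrite inE => vL; rewrite bip uL ?(negPf vL).
exists G; have r0 := spectral_radius_gt0 uv; split=> //.
have [|x [x01 xu eig]] := perron R G; first by lia.
have x0 w : 0 <= x w by case/andP: (x01 w).
have X0 : 0 < \sum_(v in L) x v.
  by apply: (embedding_sum_gt0 eig bip x0 xu _ r0); rewrite cL; lia.
set r := spectral_radius R G in eig r0 *.
pose v0 := g (inr ord0).
have v0L : v0 \in L by rewrite LE imset_f.
have xv0 : r * x v0 = \sum_(w in ~: L) x w.
  rewrite -eig /nsum; apply: eq_bigl => w; rewrite inE.
  have [wL|wL] := boolP (w \in L); last by rewrite bip ?(negPf wL) ?andbF // v0L.
  have /eqP := degL (inr ord0); rewrite degree_unionr degree_complete /= cards_eq0.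
  by move=> /eqP/setP/(_ w); rewrite !inE wL.
have D1 : \sum_(v in L) (1%:R - (deg_in G L v)%:R) * x v = x v0.
  rewrite (bigD1 v0) //= big1 ?addr0.
    by rewrite degL degree_unionr degree_complete /= subr0 mul1r.
  move=> w /andP[]; rewrite {1}LE => /imsetP[[t|t] _ ->].
    by rewrite degL degree_unionl rH subrr mul0r.
  by rewrite ord1 eqxx.
have := embedding_identity eig 1 bip; have := embedding_sumR eig bip.
rewrite D1 xv0 cL cR mul1r; set X := \sum_(v in L) x v in X0 *.
set Y := \sum_(v in ~: L) x v => E1 E2.
have E3 : r * (r ^+ 2 - r - a%:R * a%:R) + a%:R = 0.
  apply: (mulIf (x := X)); first by rewrite gt_eqF.
  rewrite mul0r mulrDl -E1 -mulrA E2; ring.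
have a5 : 5%:R <= a%:R :> R by rewrite ler_nat.
(* Dropping the inner edges of [L] gives [r^2 >= a^2], and [r = a] is incompatible with [E3]. *)
have ra : a%:R < r.
  have r2 : a%:R ^+ 2 <= r ^+ 2.
    rewrite -(ler_pM2r X0) -[_ * X]mulrA -E1.
    rewrite [X in _ <= X](_ : _ = r * (r * X)); last by ring.
    rewrite mulrCA ler_pM2l // (embedding_sumL eig bip) cL lerDr.
    by apply: sumr_ge0 => w _; apply: mulr_ge0.
  have ra : a%:R <= r by rewrite -(ler_pXn2r (n := 2)) // ?nnegrE // ltW.
  rewrite lt_neqAle ra andbT; apply/eqP => ar; move: E3 a5; rewrite -ar.
  by move: (a%:R : R) => t; clear=> E a5; exfalso; nra.
have : r * (r ^+ 2 - r - a%:R ^+ 2 + 1) > 0 by move: E3; lra.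
by rewrite pmulr_rgt0 //; lra.
Qed.
End LowerBounds.

(** * Moving a vertex to one side *)

Section Rejoin.
Variables (V : finType) (G : sgraph V) (v : V) (S : {set V}).
Hypothesis vS : v \notin S.

Definition rejoin_rel : rel V := fun a b =>
  if a == v then b \in S else if b == v then a \in S else G a b.

Lemma rejoin_sym : symmetric rejoin_rel.
Proof.
move=> a b; rewrite /rejoin_rel adj_sym.
by case: (eqVneq a v) => [->|av]; case: (eqVneq b v) => [bv|bv]; rewrite ?bv.
Qed.

Lemma rejoin_irr : irreflexive rejoin_rel.
Proof.
move=> a; rewrite /rejoin_rel adj_irr.
by case: (eqVneq a v) => [->|//]; rewrite (negPf vS).
Qed.

Definition rejoin := SGraph rejoin_sym rejoin_irr.

(* A copy of [F] through [v] in the new graph becomes a copy of [F] in [G] when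
   [v] is exchanged for a vertex [v'] adjacent to its neighbours in the copy. *)
Lemma rejoin_free (U : finType) (F : sgraph U) :
  subgraph_free F G ->
  (forall Z : {set V}, #|Z| <= #|U| ->
     exists2 v', v' \notin Z & {in S :&: Z, forall t, G v' t}) ->
  subgraph_free F rejoin.
Proof.
move=> Ffree H [f finj fhom]; apply: Ffree.
have [|v' v'Z v'S] := H (f @: U); first by rewrite card_imset // cardsT.
have neq w : f w != v' by apply: contraNneq v'Z => <-; rewrite imset_f.
exists (fun w => if f w == v then v' else f w) => [a b|a b ab].
  have [fa|fa] := eqVneq (f a) v; have [fb|fb] := eqVneq (f b) v.
  - by move=> _; apply: finj; rewrite fa fb.
  - by move=> E; have := neq b; rewrite E eqxx.
  - by move=> E; have := neq a; rewrite E eqxx.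
  - exact: finj.
have := fhom a b ab; rewrite /= /rejoin_rel.
have [fa|fa] := eqVneq (f a) v; have [fb|fb] := eqVneq (f b) v => // h.
- by have := vS; rewrite -fb h.
- by apply: v'S; rewrite inE h imset_f.
- by rewrite adj_sym; apply: v'S; rewrite inE h imset_f.
Qed.
End Rejoin.

Section RejoinSpectral.
Import Order.TTheory GRing.Theory Num.Theory.
Local Open Scope ring_scope.
Variables (R : realType) (n : nat) (U : finType) (F : sgraph U).
Variables (G : sgraph 'I_n) (x : 'I_n -> R).
Hypothesis spexG : SPEX R F G.
Hypothesis x0 : forall v, 0 <= x v.
Hypothesis eig : forall v, nsum G x v = spectral_radius R G * x v.

(** Replacing the neighbourhood of [v] by [S] creates no copy of [F], so the radius does not grow.
    The form at [x] changes by [2 * x v] times the gain at [v]; a positive gain would thus leave [x]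
    a maximiser for the new graph. *)
Lemma spex_rejoin (v : 'I_n) (S : {set 'I_n}) : v \notin S ->
  (forall Z : {set 'I_n}, (#|Z| <= #|U|)%N ->
     exists2 v', v' \notin Z & {in S :&: Z, forall t, G v' t}) ->
  \sum_(w in S) x w <= spectral_radius R G * x v.
Proof.
move=> vS H; have [Gfree Gmax] := spexG.
pose G' := rejoin G vS; have rr := Gmax G' (rejoin_free (vS := vS) Gfree H).
have nv : nsum G' x v = \sum_(w in S) x w.
  by apply: eq_bigl => w; rewrite /= /rejoin_rel eqxx.
rewrite leNgt; apply/negP => lt; move: (lt); rewrite ltNge => /negP; apply; rewrite -nv.
have nw w : w != v ->
    nsum G' x w = nsum G x w + (w \in S)%:R * x v - (G w v)%:R * x v.
  move=> wv; have D (H' : sgraph 'I_n) :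
      nsum H' x w = (H' w v)%:R * x v + \sum_(i | i != v) (H' w i)%:R * x i.
    rewrite /nsum big_mkcond (bigD1 v) //=; congr (_ + _).
      by case: (H' w v); rewrite ?mul1r ?mul0r.
    by apply: eq_bigr => i _; case: (H' w i); rewrite ?mul1r ?mul0r.
  rewrite !D; have -> : G' w v = (w \in S) by rewrite /= /rejoin_rel (negPf wv) eqxx.
  rewrite (eq_bigr (fun i => (G w i)%:R * x i)); first by ring.
  by move=> i iv; rewrite /= /rejoin_rel (negPf wv) (negPf iv).
have E : \sum_w x w * nsum G' x w = \sum_w x w * nsum G x w
    + x v * (nsum G' x v - nsum G x v) *+ 2.
  rewrite (bigD1 v) //= [in RHS](bigD1 v) //=.
  rewrite (eq_bigr (fun w => x w * nsum G x w
     + x v * ((w \in S)%:R * x w - (G v w)%:R * x w))); last first.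
    by move=> w /nw ->; rewrite [G w v]adj_sym; ring.
  rewrite big_split /= -mulr_sumr sumrB.
  have -> : \sum_(i | i != v) (i \in S)%:R * x i = nsum G' x v.
    rewrite nv [RHS]big_mkcond [RHS](bigD1 v) //= (negPf vS) add0r.
    by apply: eq_bigr => i _; case: (i \in S); rewrite ?mul1r ?mul0r.
  have -> : \sum_(i | i != v) (G v i)%:R * x i = nsum G x v.
    rewrite /nsum [RHS]big_mkcond [RHS](bigD1 v) //= adj_irr add0r.
    by apply: eq_bigr => i _; case: (G v i); rewrite ?mul1r ?mul0r.
  by ring.
(* The eigenvector equation at [v] for the new graph, rather than strict growth of the form, gives
   the contradiction; this also covers [x v = 0]. *)
suff -> : nsum G' x v = spectral_radius R G' * x v by apply: ler_wpM2r.
apply: rayleigh_eq; rewrite E; apply: ler_wpDr.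
  by rewrite mulrn_wge0 // mulr_ge0 // subr_ge0 nv eig ltW.
apply: le_trans (_ : spectral_radius R G * \sum_w x w ^+ 2 <= _).
  by apply: ler_wpM2r => //; apply: sumr_ge0 => w _; apply: sqr_ge0.
rewrite mulr_sumr; apply: ler_sum => w _; rewrite eig.
by rewrite le_eqVlt; apply/orP; left; apply/eqP; ring.
Qed.
End RejoinSpectral.

(** * Fans and common neighbours across a nearly complete pair *)

Section Embeddings.
Import Order.TTheory GRing.Theory Num.Theory.
Local Open Scope ring_scope.
Variables (R : realType) (V : finType) (G : sgraph V).

(** Otherwise [k.+1] neighbours of [v] in [P] alternate with [k + 2] of the vertices of [Q] adjacent
    to [v] and to all of them, which makes a rim around [v]. *)
Lemma cross_bound (k : nat) (P Q : {set V}) (m : R) (v : V) :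
  subgraph_free (fan (2 * k + 3)) G -> 0 <= m ->
  {in P, forall a, #|[set w in Q | ~~ G a w]|%:R <= m} ->
  (k < deg_in G P v)%N ->
  (deg_in G Q v)%:R <= k.+1%:R * m + (2 * k + 3)%:R.
Proof.
move=> free m0 Pm kv; rewrite leNgt; apply/negP => big.
pose W := [set w in Q | G v w].
have [s [us ss sP]] : exists s, [/\ uniq s, size s = k.+1
    & {subset s <= [set w in P | G v w]}].
  exists (take k.+1 (enum [set w in P | G v w])); split.
  - by rewrite take_uniq ?enum_uniq.
  - by rewrite size_takel // -cardE.
  - by move=> w /mem_take; rewrite mem_enum.
have miss : #|[set w in W | ~~ (G v w && all (G w) s)]|%:R <= k.+1%:R * m :> R.
  rewrite -ss; elim: s sP {us ss} => [|a s IH] sP.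
    rewrite mul0r (_ : [set w in W | _] = set0) ?cards0 //.
    by apply/setP => w; rewrite !inE andbT; case: (G v w); rewrite ?andbF.
  have aP : a \in P by have := sP a (mem_head _ _); rewrite inE => /andP[].
  apply: le_trans (_ : (#|[set w in Q | ~~ G a w]|
      + #|[set w in W | ~~ (G v w && all (G w) s)]|)%:R <= _).
    rewrite ler_nat; apply: leq_trans (leq_card_setU _ _).
    apply/subset_leq_card/subsetP => w; rewrite !inE /= [G w a]adj_sym.
    by case: (w \in Q); case: (G v w); case: (G a w).
  rewrite natrD /= -natr1 mulrDl mul1r addrC lerD ?Pm // IH // => w ws.
  by apply: sP; rewrite inE ws orbT.
(* The rim consists of the [k.+1] vertices of [s] and [k + 2] blocks of one vertex each. *)
apply: free; have -> : (2 * k + 3 = size s + (size s).+1 * 1)%N by rewrite ss; lia.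
apply: (@fan_of_packs _ G W 1 #|W|.-1 v) => //.
- apply: packs_vertex; have : (0 < #|W|)%N; last by lia.
  rewrite -(ltr_nat R); apply: le_lt_trans big.
  by apply: addr_ge0 => //; apply: mulr_ge0.
- by apply/allP => w /sP; rewrite inE => /andP[].
have {}big : (#|[set w in W | ~~ (G v w && all (G w) s)]| + (2 * k + 3) < #|W|)%N.
  by rewrite -(ltr_nat R) natrD; apply: le_lt_trans big; rewrite lerD2r.
by rewrite ss; lia.
Qed.

(** A union bound: at most [z] vertices lie in [Z], and at most [z * m] vertices of [P] miss some
    vertex of [Q :&: Z]. *)
Lemma common_nbr (z : nat) (P Q : {set V}) (m : R) (Z : {set V}) : 0 <= m ->
  {in Q, forall t, #|[set w in P | ~~ G t w]|%:R <= m} ->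
  (#|Z| <= z)%N -> z%:R * m + z%:R < #|P|%:R ->
  exists2 v', v' \notin Z & {in Q :&: Z, forall t, G v' t}.
Proof.
move=> m0 Qm Zz Hz.
pose bad := Z :|: \bigcup_(t in Q :&: Z) [set w in P | ~~ G t w].
have cbad : #|bad|%:R <= z%:R * m + z%:R.
  apply: le_trans (_ : (#|Z| + \sum_(t in Q :&: Z) #|[set w in P | ~~ G t w]|)%:R <= _).
    rewrite ler_nat; apply: leq_trans (leq_card_setU _ _) _; rewrite leq_add2l.
    elim/big_rec2: _ => [|t b B _ IH]; first by rewrite cards0.
    by apply: leq_trans (leq_card_setU _ _) _; rewrite leq_add2l.
  rewrite natrD addrC natr_sum; apply: lerD; last by rewrite ler_nat.
  apply: le_trans (_ : \sum_(t in Q :&: Z) m <= _).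
    by apply: ler_sum => t; rewrite inE => /andP[/Qm].
  rewrite sumr_const -[m *+ _]mulr_natl ler_wpM2r // ler_nat.
  by apply: leq_trans Zz; apply/subset_leq_card/subsetP => t; rewrite inE => /andP[].
have /card_gt0P [v'] : (0 < #|P :\: bad|)%N.
  have : (#|bad| < #|P|)%N by rewrite -(ltr_nat R); apply: le_lt_trans Hz.
  by have := cardsID bad P; have := subset_leq_card (subsetIr P bad); lia.
rewrite in_setD inE negb_or => /andP[/andP[v'Z /bigcupP v'b] v'P].
exists v' => // t tQZ; rewrite adj_sym; apply: contraT => tv'.
by exfalso; apply: v'b; exists t => //; rewrite inE v'P.
Qed.
End Embeddings.

(** * Stability *)

Section Missing.
Variables (V : finType) (G : sgraph V).

Definition miss (Q : {set V}) (v : V) : nat := #|[set w in Q | ~~ G v w]|.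

Lemma deg_in_miss (Q : {set V}) (v : V) : deg_in G Q v + miss Q v = #|Q|.
Proof.
rewrite -(cardsID [set w | G v w] Q) /deg_in /miss; congr (_ + _).
  by apply: eq_card => w; rewrite !inE.
by apply: eq_card => w; rewrite !inE andbC.
Qed.

Lemma sum_miss (P Q : {set V}) : \sum_(v in P) miss Q v = \sum_(w in Q) miss P w.
Proof.
have E (A B : {set V}) : \sum_(v in A) miss B v
    = \sum_(v in A) \sum_(w in B) ~~ G v w.
  apply: eq_bigr => v _; rewrite /miss -sum1_card big_mkcond.
  rewrite [RHS]big_mkcond; apply: eq_bigr => w _; rewrite inE.
  by case: (w \in B); case: (G v w).
rewrite !E exchange_big; apply: eq_bigr => w _; apply: eq_bigr => v _.
by rewrite adj_sym.
Qed.

Lemma deg_in_le (P Q : {set V}) (v : V) : P \subset Q -> deg_in G P v <= deg_in G Q v.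
Proof.
move=> /subsetP PQ; apply/subset_leq_card/subsetP => w.
by rewrite !inE => /andP[/PQ-> ->].
Qed.

Lemma deg_in_setU (P Q : {set V}) (v : V) :
  deg_in G (P :|: Q) v <= deg_in G P v + deg_in G Q v.
Proof.
apply: leq_trans (leq_card_setU _ _); apply/subset_leq_card/subsetP => w.
by rewrite !inE; case: (w \in P); case: (w \in Q); case: (G v w).
Qed.

Lemma miss_le (P Q : {set V}) (v : V) : P \subset Q -> miss P v <= miss Q v.
Proof.
move=> /subsetP PQ; apply/subset_leq_card/subsetP => w.
by rewrite !inE => /andP[/PQ-> ->].
Qed.

Lemma sum_deg_nbr (l : nat) (v : V) : subgraph_free (fan l) G ->
  \sum_(w in [set w | G v w]) deg_in G [set w | G v w] w
    <= 2 * l * #|[set w | G v w]|.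
Proof.
move=> free; apply: sum_deg_path_free => p up sp pN; apply/eqP => sz.
apply/free/contains_fanP; exists v, p; split=> //.
by apply/allP => w /pN; rewrite inE.
Qed.
End Missing.

Section Stability.
Import Order.TTheory GRing.Theory Num.Theory.
Local Open Scope ring_scope.
Variables (R : realType) (V : finType) (G : sgraph V) (x : V -> R) (r : R).
Variable k : nat.
Let n : R := #|V|%:R.
Let kr : R := k%:R.
Let K : R := 1000%:R * (kr + 2%:R).
(** This is [2 * (2 * k + 3)], the constant of [sum_deg_path_free] for the rim length
    [2 * k + 3]. *)
Let C : R := 4%:R * kr + 6%:R.
(* The error scale: below, sizes, degrees and weighted degrees are known up to
   [O((k + 2) e)], and [K] makes this a small fraction of [n]. *)
Let e : R := n / K.
Hypothesis eig : forall v, nsum G x v = r * x v.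
Hypothesis x01 : forall v, 0 <= x v <= 1.
Hypothesis xu : exists u, x u = 1.
Hypothesis free : subgraph_free (fan (2 * k + 3)) G.
Hypothesis rlow : #|V|%:R <= 2%:R * r.
(** The conclusion of [spex_rejoin]; the fan has [2 * k + 4] vertices. *)
Hypothesis repl : forall (v : V) (S : {set V}), v \notin S ->
  (forall Z : {set V}, (#|Z| <= 2 * k + 4)%N ->
     exists2 v', v' \notin Z & {in S :&: Z, forall t, G v' t}) ->
  \sum_(w in S) x w <= r * x v.
Hypothesis nlarge : 100%:R * (4%:R * k%:R + 6%:R)
  * (1000%:R * (k%:R + 2%:R)) ^+ 2 <= #|V|%:R :> R.

Lemma x_ge0 v : 0 <= x v. Proof. by case/andP: (x01 v). Qed.
Lemma x_le1 v : x v <= 1. Proof. by case/andP: (x01 v). Qed.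

Lemma K_gt0 : 0 < K :> R. Proof. by have : 0 <= kr := ler0n _ _; rewrite /K; lra. Qed.

Lemma eK : e * K = n :> R. Proof. by rewrite mulfVK // gt_eqF ?K_gt0. Qed.

Lemma e_large : 100%:R * C * K <= e :> R.
Proof.
by rewrite ler_pdivlMr ?K_gt0 //; move: nlarge; rewrite -/kr -/C -/K -/n expr2 !mulrA.
Qed.

Lemma k_ge0 : 0 <= kr :> R. Proof. exact: ler0n. Qed.

Lemma e_facts : [/\ 1000%:R * ((kr + 2) * e) = n :> R,
   400%:R * (kr + 2) <= e :> R, 100%:R * C <= e :> R & 3%:R * 100%:R <= e :> R].
Proof.
have hk := eK; have he := e_large; have k0 := k_ge0.
move: hk he; rewrite /K /C; move: (e) (kr) k0 => e' k' k0 hk he.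
by split; [rewrite -hk; ring | nra..].
Qed.

Lemma n_large : 0 < n /\ 1000%:R * e <= n.
Proof.
have [h1 h2 h3 h4] := e_facts; have k0 := k_ge0.
have : 0 <= kr * e by apply: mulr_ge0; lra.
by split; lra.
Qed.

Lemma card_split (B : {set V}) : #|~: B|%:R + #|B|%:R = n :> R.
Proof. by rewrite -natrD addnC cardsC. Qed.

(** Take [B0] to be the neighbourhood of a vertex of weight 1 and expand [r^2] at it. The 2-walks
    ending in [B0] cost at most [C * #|B0|], since [B0] contains no long path; the others are
    compared with the product of the part sizes. *)
Lemma first_partition : exists B0 : {set V},
  r ^+ 2 + \sum_(w in ~: B0) (#|B0|%:R - (deg_in G B0 w)%:R * x w)
    <= #|~: B0|%:R * #|B0|%:R + C * #|B0|%:R.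
Proof.
have [u xu1] := xu; pose B0 := [set w | G u w]; exists B0.
rewrite big_split /= sumrN sumr_const -[X in _ + (X - _)]mulr_natl.
have E : r ^+ 2 = r * \sum_(w in B0) x w.
  have := eig u; rewrite xu1 mulr1 /nsum => <-.
  by congr (_ * _); apply: eq_bigl => w; rewrite inE.
rewrite E (eig_sum eig).
suff : \sum_(w in B0) (deg_in G B0 w)%:R * x w <= C * #|B0|%:R by lra.
apply: (@le_trans _ _ (\sum_(w in B0) (deg_in G B0 w)%:R)).
  by apply: ler_sum => w _; rewrite ler_piMr // x_le1.
rewrite -natr_sum; have := sum_deg_nbr u free; rewrite -(ler_nat R) -/B0.
by rewrite /C /kr !natrM natrD !natrM; lra.
Qed.

Section FirstPartition.
Variable B0 : {set V}.
Local Notation A0 := (~: B0).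
Local Notation a0 := (#|A0|%:R).
Local Notation b0 := (#|B0|%:R).
Hypothesis H0 : r ^+ 2 + \sum_(w in A0) (b0 - (deg_in G B0 w)%:R * x w)
  <= a0 * b0 + C * b0.

Lemma loss_split w : b0 - (deg_in G B0 w)%:R * x w
  = (miss G B0 w)%:R + (deg_in G B0 w)%:R * (1 - x w).
Proof. by rewrite -(deg_in_miss G B0 w) natrD; ring. Qed.

(** Since [r^2 >= n^2 / 4] while the product of the parts is at most [n^2 / 4], only the error
    [C * n] is left for the missing edges, the lost weight and the imbalance. *)
Lemma total_loss :
  \sum_(w in A0) (miss G B0 w)%:R
  + \sum_(w in A0) (deg_in G B0 w)%:R * (1 - x w) <= C * n /\
  r ^+ 2 <= a0 * b0 + C * n /\ (a0 - b0) ^+ 2 <= 4%:R * C * n :> R.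
Proof.
rewrite -big_split /= -(eq_bigr _ (fun w _ => loss_split w)).
have s0 : 0 <= \sum_(w in A0) (b0 - (deg_in G B0 w)%:R * x w).
  apply: sumr_ge0 => w _; rewrite loss_split addr_ge0 // mulr_ge0 //.
  by rewrite subr_ge0 x_le1.
have r2 : n ^+ 2 <= 4%:R * r ^+ 2.
  by move: rlow (ler0n R #|V|) => ? ?; nra.
move: H0 (card_split B0) (ler0n R #|B0|) (ler0n R #|A0|) k_ge0 s0 r2.
set S := \sum_(w in _) _; rewrite /C; move: (n) (kr) (a0) (b0) S (r ^+ 2).
move=> n' k' a b S r' H ab b_0 a_0 k_0 S0 r2.
have Cb : (4%:R * k' + 6%:R) * b <= (4%:R * k' + 6%:R) * n' by nra.
have E : (a - b) ^+ 2 = n' ^+ 2 - 4%:R * (a * b) by rewrite -ab; ring.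
have sq : 0 <= (a - b) ^+ 2 by apply: sqr_ge0.
split; last split; lra.
Qed.

Lemma ab_close : `|a0 - b0| <= e :> R.
Proof.
have [_ [_ H]] := total_loss; have [_ h2 h3 h4] := e_facts.
have e0 : 0 <= e by lra.
rewrite -(ler_pXn2r (n := 2)) ?nnegrE // real_normK ?num_real //.
apply: le_trans H _; have := eK; have := e_large; have := K_gt0; have := k_ge0.
rewrite /C; move: (e) e0 => e' e0; move: (K) (kr) => K' k' k_0 K0 eL <-.
rewrite expr2 [X in X <= _](_ : _ = (4%:R * (4%:R * k' + 6%:R) * K') * e');
  last by ring.
by apply: ler_wpM2r => //; nra.
Qed.

Lemma r_upper : r <= n / 2%:R + e.
Proof.
have [_ [H _]] := total_loss; have [_ h2 h3 h4] := e_facts.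
rewrite leNgt; apply/negP => lt.
have ab := card_split B0; have n0 := ler0n R #|V|.
move: H h2 h3 h4 lt ab n0 k_ge0; rewrite -/n /C; move: (e) => e'.
move: (n) (kr) (a0) (b0) => n' k' a b.
move=> H h2 h3 h4 lt ab n0 k_0.
have : (n' / 2%:R + e') ^+ 2 < r ^+ 2.
  by rewrite ltr_pXn2r ?nnegrE //; lra.
have : (4%:R * k' + 6%:R) * n' <= e' * n' by apply: ler_wpM2r => //; lra.
have E : (a - b) ^+ 2 = n' ^+ 2 - 4%:R * (a * b) by rewrite -ab; ring.
have sq : 0 <= (a - b) ^+ 2 by apply: sqr_ge0.
have sqe : 0 <= e' ^+ 2 by apply: sqr_ge0.
by lra.
Qed.

(** Markov's inequality: [C * n = C * K * e] is at most [e ^+ 2 / 100]. *)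
Lemma card_exceptions (P : {set V}) (f : V -> nat) :
  (\sum_(w in P) f w)%:R <= C * n :> R ->
  #|[set w in P | ~~ ((f w)%:R <= e :> R)]|%:R <= e / 100%:R :> R.
Proof.
set bad := [set w in P | _] => H.
have {H} : #|bad|%:R * e <= C * n.
  apply: le_trans H; rewrite natr_sum mulr_natl -sumr_const.
  apply: (@le_trans _ _ (\sum_(w in bad) (f w)%:R)).
    by apply: ler_sum => w; rewrite inE -ltNge => /andP[_ /ltW].
  rewrite [X in _ <= X](bigID (mem bad)) /= -[leLHS]addr0 lerD ?sumr_ge0 //.
  rewrite le_eqVlt; apply/orP; left; apply/eqP; apply: eq_bigl => w.
  by rewrite inE; case: (w \in P).
have [_ h2 h3 h4] := e_facts; have := eK; have := e_large.
set b := #|bad|%:R; move: (e) h2 h3 h4 => e' h2 h3 h4; move: (K) => K' eL <-.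
rewrite [X in _ <= X -> _](_ : _ = (C * K') * e'); last by ring.
by rewrite ler_pM2r; lra.
Qed.

Definition good_left := [set w in A0 | (miss G B0 w)%:R <= e :> R].
Definition good_right := [set w in B0 | (miss G A0 w)%:R <= e :> R].
Local Notation A1 := good_left.
Local Notation B1 := good_right.

Lemma sum_miss_bound : (\sum_(w in A0) miss G B0 w)%:R <= C * n :> R.
Proof.
have [H _] := total_loss; apply: le_trans H; rewrite natr_sum lerDl.
by apply: sumr_ge0 => w _; rewrite mulr_ge0 // subr_ge0 x_le1.
Qed.

Lemma card_good_left : a0 - e / 100%:R <= #|A1|%:R :> R.
Proof.
have := card_exceptions sum_miss_bound.
have : (#|A1| + #|[set w in A0 | ~~ ((miss G B0 w)%:R <= e :> R)]| = #|A0|)%N.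
  rewrite -(cardsID [set w | (miss G B0 w)%:R <= e :> R] A0); congr (_ + _)%N.
    by apply: eq_card => w; rewrite !inE.
  by apply: eq_card => w; rewrite !inE andbC.
by move=> <-; rewrite natrD; lra.
Qed.

Lemma card_good_right : b0 - e / 100%:R <= #|B1|%:R :> R.
Proof.
have : (\sum_(w in B0) miss G A0 w)%:R <= C * n :> R.
  by rewrite sum_miss; apply: sum_miss_bound.
move=> /card_exceptions.
have : (#|B1| + #|[set w in B0 | ~~ ((miss G A0 w)%:R <= e :> R)]| = #|B0|)%N.
  rewrite -(cardsID [set w | (miss G A0 w)%:R <= e :> R] B0); congr (_ + _)%N.
    by apply: eq_card => w; rewrite !inE.
  by apply: eq_card => w; rewrite !inE andbC.
by move=> <-; rewrite natrD; lra.
Qed.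

Lemma good_part_sizes : [/\ n / 2%:R - e <= #|A1|%:R :> R, n / 2%:R - e <= #|B1|%:R :> R,
  a0 <= n / 2%:R + e :> R & b0 <= n / 2%:R + e :> R].
Proof.
have := ab_close; rewrite ler_norml => /andP[l1 l2].
have := card_split B0; have := card_good_left; have := card_good_right.
have [_ h2 h3 h4] := e_facts; split; lra.
Qed.

(** A good vertex has at least [n / 4] neighbours in [B0], so its lost weight is counted that often
    in [total_loss]. *)
Lemma good_left_loss : \sum_(w in A1) (1 - x w) <= e.
Proof.
have [H _] := total_loss; have [s1 s2 s3 s4] := good_part_sizes.
have [h1 h2 h3 h4] := e_facts; have k0 := k_ge0.
have [n0 e4] := n_large.
have b4 : 2%:R * e <= b0.
  have := card_split B0; lra.
have Hsum : (n / 4%:R) * \sum_(w in A1) (1 - x w) <= C * n.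
  apply: le_trans H; rewrite mulr_sumr.
  apply: (@le_trans _ _ (\sum_(w in A1) (deg_in G B0 w)%:R * (1 - x w))).
    apply: ler_sum => w; rewrite inE => /andP[_ mw].
    apply: ler_wpM2r; first by rewrite subr_ge0 x_le1.
    have /(congr1 (fun m => m%:R : R)) := deg_in_miss G B0 w.
    rewrite natrD => dm; have := card_split B0; lra.
  rewrite -[leLHS]add0r; apply: lerD; first exact: sumr_ge0.
  rewrite [X in _ <= X](bigID (mem A1)) /= -[leLHS]addr0; apply: lerD.
    rewrite le_eqVlt; apply/orP; left; apply/eqP; apply: eq_bigl => w.
    by rewrite !inE; case: (w \in B0).
  by apply: sumr_ge0 => w _; rewrite mulr_ge0 // subr_ge0 x_le1.
have : (n / 4%:R) * \sum_(w in A1) (1 - x w) <= (n / 4%:R) * e.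
  by apply: le_trans Hsum _; nra.
by rewrite ler_pM2l //; lra.
Qed.

Lemma x_from_rx v c : 0 <= c -> n / 2%:R - c <= r * x v ->
  n * (1 - x v) <= 2%:R * (c + e).
Proof.
move=> c0 H; have ru := r_upper; have := x_le1 v; have := x_ge0 v.
move: rlow H ru; rewrite -/n; move: (e) (n) => e' n' rl H ru X0 X1; nra.
Qed.

(** Such a vertex sees all but [e] vertices of [good_left], whose total lost weight is at most [e];
    hence [r * x v] is close to [n / 2]. *)
Lemma x_good_right v : v \in B1 -> n * (1 - x v) <= 12%:R * e.
Proof.
rewrite inE => /andP[vB mv]; have [_ h2 h3 h4] := e_facts.
have -> : 12%:R * e = 2%:R * (5%:R * e + e) by ring.
apply: x_from_rx; first by lra.
rewrite -eig; apply: (@le_trans _ _ (\sum_(w in A1 | G v w) x w)); last first.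
  rewrite /nsum [X in _ <= X](bigID (mem A1)) /= -[leLHS]addr0; apply: lerD.
    by rewrite le_eqVlt; apply/orP; left; apply/eqP/eq_bigl => w; rewrite andbC.
  by apply: sumr_ge0 => w _; apply: x_ge0.
have L := good_left_loss; have [s1 _ _ _] := good_part_sizes.
have : \sum_(w in A1) x w <= \sum_(w in A1 | G v w) x w + e.
  rewrite (bigID (G v)) /= lerD2l; apply: le_trans mv.
  apply: (@le_trans _ _ (\sum_(w in A1 | ~~ G v w) 1)).
    by apply: ler_sum => w _; apply: x_le1.
  rewrite sumr_const ler_nat; apply/subset_leq_card/subsetP => w.
  rewrite !inE => /andP[+ ->]; rewrite inE => /andP[+ _].
  by rewrite inE andbT.
move: L; rewrite sumrB sumr_const; lra.
Qed.

Lemma good_right_loss (S : {set V}) : S \subset B1 ->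
  \sum_(w in S) (1 - x w) <= 12%:R * e.
Proof.
have [h1 h2 h3 h4] := e_facts; have k0 := k_ge0 => /subsetP SB.
have [n0 e4] := n_large.
rewrite -(ler_pM2l n0) mulr_sumr.
apply: (@le_trans _ _ (\sum_(w in S) 12%:R * e)).
  by apply: ler_sum => w /SB /x_good_right.
rewrite sumr_const -[leLHS]mulr_natl; apply: ler_wpM2r; first by lra.
by rewrite ler_nat max_card.
Qed.

(** An arbitrary vertex could be rejoined to [good_right]: boundedly many vertices there always have
    a common neighbour in the other part outside a given small set. So [r * x v] is at least the
    weight of [good_right] without [v]. *)
Lemma rx_lower v : n / 2%:R - 15%:R * e <= r * x v.
Proof.
have [h1 h2 h3 h4] := e_facts; have k0 := k_ge0.
have [s1 s2 s3 s4] := good_part_sizes.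
apply: (@le_trans _ _ (\sum_(w in B1 :\ v) x w)).
  have := good_right_loss (subD1set B1 v); rewrite sumrB sumr_const.
  have : (#|B1| <= #|B1 :\ v| + 1)%N by rewrite (cardsD1 v B1) addnC leq_add2l leq_b1.
  by rewrite -(ler_nat R) natrD; lra.
apply: repl; first by rewrite !inE eqxx.
move=> Z Zk; apply: (@common_nbr R _ G (2 * k + 4) A0 _ e Z) => //.
- by lra.
- by move=> t; rewrite !inE => /andP[_ /andP[_]].
rewrite natrD natrM; have := card_split B0; nra.
Qed.

Lemma x_lower v : n * (1 - x v) <= 32%:R * e.
Proof.
have [h1 h2 h3 h4] := e_facts.
have -> : 32%:R * e = 2%:R * (15%:R * e + e) by ring.
by apply: x_from_rx; [lra|apply: rx_lower].
Qed.

(** This precision makes [k.+1] vertices lose at most half a unit of weight together, as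
    [near_complete_final] requires. *)
Lemma one_minus_x v : 2%:R * (kr + 1) * (1 - x v) <= 1.
Proof.
have [h1 h2 h3 h4] := e_facts; have := x_lower v; have k0 := k_ge0.
have e0 : 0 < e by lra.
rewrite -h1 => H.
have : 1000%:R * (kr + 2) * (1 - x v) <= 32%:R.
  rewrite -(ler_pM2r e0); apply: le_trans H; rewrite le_eqVlt.
  by apply/orP; left; apply/eqP; ring.
have := x_le1 v; nra.
Qed.

Lemma deg_lower v : n / 2%:R - 15%:R * e <= (deg_in G [set: V] v)%:R :> R.
Proof.
apply: le_trans (rx_lower v) _; rewrite -eig /nsum /deg_in -sum1_card natr_sum.
rewrite [X in _ <= X](eq_bigl (G v)); last by move=> w; rewrite !inE.
by apply: ler_sum => w _; apply: x_le1.
Qed.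

Lemma deg_split v : n / 2%:R - 16%:R * e
  <= (deg_in G A1 v)%:R + (deg_in G B1 v)%:R :> R.
Proof.
have := deg_lower v; have := card_good_left; have := card_good_right.
have := card_split B0; have [h1 h2 h3 h4] := e_facts.
have : (deg_in G [set: V] v <= deg_in G A1 v + deg_in G B1 v + #|~: (A1 :|: B1)|)%N.
  rewrite -(setUCr (A1 :|: B1)).
  apply: leq_trans (deg_in_setU _ _ _ _) _; rewrite leq_add //.
    exact: deg_in_setU.
  by apply/subset_leq_card/subsetP => w; rewrite inE => /andP[].
have : (#|A1| + #|B1| + #|~: (A1 :|: B1)| = #|V|)%N.
  rewrite -(cardsC (A1 :|: B1)) cardsU (_ : A1 :&: B1 = set0).
    by rewrite cards0 subn0.
  by apply/setP => w; rewrite !inE; case: (w \in B0); rewrite ?andbF.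
move=> /(congr1 (fun m => m%:R : R)); rewrite -(ler_nat R) !natrD; lra.
Qed.

Lemma cross_right v : (k < deg_in G A1 v)%N ->
  (deg_in G B1 v)%:R <= 2%:R * ((kr + 2) * e) :> R.
Proof.
move=> kv; have [h1 h2 h3 h4] := e_facts; have k0 := k_ge0.
have /(_ _ _ kv) := @cross_bound R V G k A1 B1 e v free.
rewrite natrD natrM -natr1 => H; apply: le_trans (H _ _) _; [lra| |nra].
move=> a; rewrite !inE => /andP[_]; apply: le_trans; rewrite ler_nat.
by apply/miss_le/subsetP => w; rewrite inE => /andP[].
Qed.

Lemma cross_left v : (k < deg_in G B1 v)%N ->
  (deg_in G A1 v)%:R <= 2%:R * ((kr + 2) * e) :> R.
Proof.
move=> kv; have [h1 h2 h3 h4] := e_facts; have k0 := k_ge0.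
have /(_ _ _ kv) := @cross_bound R V G k B1 A1 e v free.
rewrite natrD natrM -natr1 => H; apply: le_trans (H _ _) _; [lra| |nra].
move=> a; rewrite !inE => /andP[_]; apply: le_trans; rewrite ler_nat.
by apply/miss_le/subsetP => w; rewrite inE => /andP[].
Qed.

(** Every vertex, good or not, is reassigned by its number of neighbours in [good_left]: more than
    [k] of them leave room for few in [good_right], and conversely. *)
Definition final_left := [set v | (deg_in G A1 v <= k)%N].
Local Notation A := final_left.

Lemma final_left_deg v : v \in A -> n / 2%:R - 17%:R * e <= (deg_in G B1 v)%:R :> R.
Proof.
rewrite inE -(ler_nat R) => kv; have [h1 h2 h3 h4] := e_facts.
by have := deg_split v; have := k_ge0; lra.
Qed.

Lemma final_right_deg v : v \notin A ->
  (deg_in G B1 v <= k)%N /\ n / 2%:R - 17%:R * e <= (deg_in G A1 v)%:R :> R.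
Proof.
rewrite inE -ltnNge => kv; have [h1 h2 h3 h4] := e_facts; have k0 := k_ge0.
have ke : 0 <= kr * e by apply: mulr_ge0; lra.
have dB : (deg_in G B1 v <= k)%N.
  rewrite leqNgt; apply/negP => /cross_left; have := cross_right kv.
  have := deg_split v; lra.
split=> //; move: dB; rewrite -(ler_nat R); have := deg_split v; lra.
Qed.

Lemma good_left_sub : A1 \subset A.
Proof.
apply/subsetP => w wA1; apply: contraT => /final_right_deg [+ _].
move: wA1; rewrite inE => /andP[_]; have := card_good_right.
have := deg_in_miss G B1 w; have : (miss G B1 w <= miss G B0 w)%N.
  by apply/miss_le/subsetP => z; rewrite inE => /andP[].
move=> + /(congr1 (fun m => m%:R : R)); rewrite natrD -!(ler_nat R).
have [h1 h2 h3 h4] := e_facts; have k0 := k_ge0; have [s1 s2 s3 s4] := good_part_sizes.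
have ke : 0 <= kr * e by apply: mulr_ge0; lra.
by move=> ? ? ? ? ?; exfalso; lra.
Qed.

Lemma good_right_sub : B1 \subset ~: A.
Proof.
apply/subsetP => w wB1; rewrite in_setC inE -ltnNge -(ltr_nat R).
move: wB1; rewrite inE => /andP[_]; have := card_good_left.
have := deg_in_miss G A1 w; have : (miss G A1 w <= miss G A0 w)%N.
  by apply/miss_le/subsetP => z; rewrite inE => /andP[].
move=> + /(congr1 (fun m => m%:R : R)); rewrite natrD -!(ler_nat R).
have [h1 h2 h3 h4] := e_facts; have k0 := k_ge0; have [s1 s2 s3 s4] := good_part_sizes.
have ke : 0 <= kr * e by apply: mulr_ge0; lra.
by lra.
Qed.
End FirstPartition.

Definition near_complete (A : {set V}) :=
  [/\ n / 2%:R - 2%:R * e <= #|A|%:R :> R, n / 2%:R - 2%:R * e <= #|~: A|%:R :> R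
    & {in A, forall v, (miss G (~: A) v)%:R <= 19%:R * e :> R}].

Lemma near_complete_exists :
  exists A, near_complete A /\ near_complete (~: A).
Proof.
have [B0 H0] := first_partition; exists (final_left B0).
have [h1 h2 h3 h4] := e_facts; have [s1 s2 s3 s4] := good_part_sizes H0.
have lA : n / 2%:R - 2%:R * e <= #|final_left B0|%:R :> R.
  have := subset_leq_card (good_left_sub H0); rewrite -(ler_nat R); lra.
have lB : n / 2%:R - 2%:R * e <= #|~: final_left B0|%:R :> R.
  have := subset_leq_card (good_right_sub H0); rewrite -(ler_nat R); lra.
have lAB := card_split (final_left B0).
split; split; rewrite ?setCK // => v vA.
  have := final_left_deg H0 vA; have := deg_in_miss G (~: final_left B0) v.
  have := deg_in_le G v (good_right_sub H0).
  move=> + /(congr1 (fun m => m%:R : R)); rewrite natrD -!(ler_nat R); lra.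
have [|_ dv] := final_right_deg H0 (v := v); first by rewrite -in_setC.
have := deg_in_miss G (final_left B0) v.
have := deg_in_le G v (good_left_sub H0).
move: dv => + + /(congr1 (fun m => m%:R : R)); rewrite natrD -!(ler_nat R); lra.
Qed.

(** More than [k] inner neighbours would contradict [cross_bound]. Rejoining [v] to the whole
    opposite side gains almost 1 per missing vertex and loses at most 1 per inner neighbour, so the
    missing vertices cannot outnumber the inner neighbours. *)
Lemma near_complete_final (A : {set V}) : near_complete A -> near_complete (~: A) ->
  {in A, forall v, (deg_in G A v <= k)%N /\ (miss G (~: A) v <= deg_in G A v)%N}.
Proof.
move=> [nA nB mA] [_ _ mB] v vA; rewrite setCK in mB.
have [B0 H0] := first_partition.
have [h1 h2 h3 h4] := e_facts; have k0 := k_ge0.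
have ke : 0 <= kr * e by apply: mulr_ge0; lra.
have dk : (deg_in G A v <= k)%N.
  rewrite leqNgt; apply/negP => kv.
  have /(_ _ _ kv) := @cross_bound R V G k A (~: A) (19%:R * e) v free.
  move=> /(_ _ mA); rewrite natrD natrM -natr1 => H.
  have {}H := H ltac:(lra); have := mA v vA.
  have /(congr1 (fun m => m%:R : R)) := deg_in_miss G (~: A) v.
  by rewrite natrD; nra.
split=> //; rewrite leqNgt; apply/negP => dm.
have : \sum_(w in ~: A) x w <= r * x v.
  apply: repl; first by rewrite in_setC negbK.
  move=> Z Zk; apply: (@common_nbr R _ G (2 * k + 4) A _ (19%:R * e) Z) => //.
    by lra.
  by rewrite natrD natrM; nra.
rewrite -eig /nsum (bigID (G v)) /= [X in _ <= X](bigID (mem (~: A))) /=.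
rewrite [X in X + _ <= _](eq_bigl (fun w => G v w && (w \in ~: A))); last first.
  by move=> w; rewrite andbC.
rewrite lerD2l leNgt => /negP; apply.
apply: (@le_lt_trans _ _ (deg_in G A v)%:R).
  rewrite /deg_in -sum1_card natr_sum.
  rewrite [X in _ <= X](eq_bigl (fun w => G v w && (w \notin ~: A))).
    by apply: ler_sum => w _; apply: x_le1.
  by move=> w; rewrite !inE negbK andbC.
(* With [d <= k] inner neighbours and at least [d + 1] missing vertices, the gain exceeds [d]
   because [(d + 1) / (2 * (k + 1)) <= 1 / 2]. *)
apply: (@lt_le_trans _ _ (\sum_(w in ~: A | ~~ G v w)
   (1 - (2%:R * (kr + 1))^-1))); last first.
  apply: ler_sum => w _; rewrite lerBlDr -lerBlDl.
  rewrite -(ler_pM2l (x := 2%:R * (kr + 1))); last by lra.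
  by rewrite mulfV ?(one_minus_x H0) // gt_eqF //; lra.
rewrite sumr_const (_ : #|_| = miss G (~: A) v); last first.
  by apply: eq_card => w; rewrite [RHS]inE.
have i0 : 0 < (2%:R * (kr + 1))^-1 by rewrite invr_gt0; lra.
have i1 : (2%:R * (kr + 1)) * (2%:R * (kr + 1))^-1 = 1.
  by rewrite mulfV // gt_eqF //; lra.
rewrite -[(1 - _) *+ _]mulr_natl; move: dm dk; rewrite -!(ler_nat R) -natr1.
move: (_^-1) i0 i1 => i i0 i1.
move: (deg_in G A v)%:R (miss G (~: A) v)%:R => d m dm dk.
have ki : 0 <= kr * i by apply: mulr_ge0 => //; apply: ltW.
have di : 0 <= (kr - d) * i by apply: mulr_ge0; rewrite ?subr_ge0 // ltW.
have mi : 0 <= (m - d - 1) * (1 - i) by apply: mulr_ge0; lra.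
by lra.
Qed.

Lemma dense_structure : exists A : {set V},
  [/\ forall v, 1 <= 2%:R * x v,
      (#|V| <= 4 * #|A|)%N /\ (#|V| <= 4 * #|~: A|)%N,
      {in A, forall v, (deg_in G A v <= k)%N /\ (miss G (~: A) v <= deg_in G A v)%N}
    & {in ~: A, forall v,
        (deg_in G (~: A) v <= k)%N /\ (miss G A v <= deg_in G (~: A) v)%N}].
Proof.
have [A [nA nB]] := near_complete_exists; exists A.
have [h1 h2 h3 h4] := e_facts; have k0 := k_ge0.
have ke : 0 <= kr * e by apply: mulr_ge0; lra.
split.
- move=> v; have [B0 H0] := first_partition; have := one_minus_x H0 v.
  by have := x_le1 v; nra.
- case: nA => ? ? _; rewrite -!(ler_nat R) !natrM; split; lra.
- exact: near_complete_final.
- by have := near_complete_final nB; rewrite setCK; apply.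
Qed.
End Stability.

(** * One side has no edges *)

Section Constants.
Variable k : nat.

(* A centre and at most [k] of its neighbours miss at most [k * k.+1] vertices,
   and the fans below use at most [4 * k + 3] further ones. *)
Definition avoidable_size := 3 * (k + 2) ^ 2.
(** The bound of [packs_star]: more than this many vertices of degree at least [j] yield stars that
    avoid any [avoidable_size] vertices. *)
Definition few_size := k.+1 * avoidable_size.
Definition side_threshold :=
  48 * (k * few_size) + 4 * (k.+1 ^ k * (avoidable_size + 4 * (k * few_size + 1)))
  + 4 * k + 10.

Lemma side_threshold_bounds (n a : nat) : side_threshold < n -> n <= 4 * a ->
  [/\ 2 * (2 * k + 5) <= n, 12 * (k * few_size) < a
    & k.+1 ^ k * (avoidable_size + 4 * (k * few_size + 1)) < a].
Proof.
rewrite /side_threshold; set s := _ * (avoidable_size + _); set t := k * few_size => h1 h2.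
split; lia.
Qed.
End Constants.

Section OneSide.
Import Order.TTheory GRing.Theory Num.Theory.
Local Open Scope ring_scope.
Variables (R : realType) (V : finType) (G : sgraph V) (x : V -> R) (r : R).
Variable k : nat.
Hypothesis k_gt0 : (0 < k)%N.
Hypothesis eig : forall v, nsum G x v = r * x v.
Hypothesis x01 : forall v, 0 <= x v <= 1.
Hypothesis xhalf : forall v, 1 <= 2%:R * x v.
Hypothesis free : subgraph_free (fan (2 * k + 3)) G.
Hypothesis rlow : #|V|%:R <= 2%:R * r.
(** The candidates reach the floor of [n^2 / 4], up to 1 when parity forbids a [k]-regular graph on
    half of the vertices; that needs [k] odd. *)
Hypothesis rquad :
  (#|V| ^ 2 %/ 4)%:R - (odd k)%:R <= r ^+ 2 - k%:R * r.

Hypothesis nlarge : (side_threshold k < #|V|)%N.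
Local Notation avoidable_size := (avoidable_size k).
Local Notation few_size := (few_size k).

Definition balanced (A : {set V}) :=
  [/\ (#|V| <= 4 * #|A|)%N,
      {in A, forall v, (deg_in G A v <= k)%N /\ (miss G (~: A) v <= deg_in G A v)%N}
    & {in ~: A, forall v,
        (deg_in G (~: A) v <= k)%N /\ (miss G A v <= deg_in G (~: A) v)%N}].

Lemma card_not_common (Q : {set V}) (c : V) (s : seq V) :
  (#|[set w in Q | ~~ (G c w && all (G w) s)]|
     <= miss G Q c + \sum_(a <- s) miss G Q a)%N.
Proof.
elim: s => [|a s IH].
  rewrite big_nil addn0; apply/subset_leq_card/subsetP => w.
  by rewrite !inE andbT.
rewrite big_cons addnCA; apply: leq_trans (leq_add (leqnn _) IH).
apply: leq_trans (leq_card_setU _ _); apply/subset_leq_card/subsetP => w.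
rewrite !inE /= [G w a]adj_sym.
by case: (w \in Q); case: (G c w); case: (G a w).
Qed.

Lemma packs_fan (Q : {set V}) (j : nat) (c : V) (s : seq V) :
  (0 < j)%N -> packs G Q j avoidable_size -> uniq s -> all (G c) s ->
  (miss G Q c <= k)%N -> {in s, forall a, (miss G Q a <= k)%N} ->
  (size s <= k)%N -> ((size s).+1 * j <= 3 * k + 3)%N ->
  (size s + (size s).+1 * j <= 2 * k + 2)%N.
Proof.
move=> j0 pk us cs mc ms sk sj; rewrite leqNgt; apply/negP => H; apply: free.
apply: contains_fan_leq (_ : (2 * k + 3 <= size s + (size s).+1 * j)%N) _.
  by lia.
apply: (fan_of_packs j0 pk us cs); have := card_not_common Q c s.
have : (\sum_(a <- s) miss G Q a <= k * size s)%N.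
  elim: s ms {us cs sk sj H} => [|a s IH] ms; first by rewrite big_nil.
  rewrite big_cons /= mulnS leq_add ?ms ?mem_head // IH // => b bs.
  by apply: ms; rewrite inE bs orbT.
have : (k * size s <= k * k)%N by rewrite leq_mul2l sk orbT.
rewrite /avoidable_size; move: (\sum_(a <- s) _)%N => S h1 h2 h3.
have h4 := leq_trans h3 (leq_add mc (leq_trans h2 h1)).
by rewrite -addnA; apply: leq_trans (leq_add h4 (leq_add sk sj)) _; lia.
Qed.

(** With [v] as centre, its inner neighbours separate [(deg_in G A v).+1] paths on [j.+1] vertices
    packed in the opposite side; the bound says that this rim is too short for the forbidden fan. *)
Lemma balanced_pack_bound (A : {set V}) (j : nat) (v : V) : balanced A ->
  v \in A -> (0 < j <= 2)%N ->
  (few_size < #|[set w in ~: A | j <= deg_in G (~: A) w]|)%N ->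
  (deg_in G A v + (deg_in G A v).+1 * j.+1 <= 2 * k + 2)%N.
Proof.
move=> [_ hA hB] vA j12 big.
have pk : packs G (~: A) j.+1 avoidable_size.
  by apply: (packs_star (k := k)) => // w /hB [].
have [dk mk] := hA v vA; set d := deg_in G A v in dk mk *.
pose s := enum [set w in A | G v w].
have Es : d = size s by rewrite /s -cardE.
have us : uniq s by apply: enum_uniq.
have vs : all (G v) s by apply/allP => w; rewrite mem_enum inE => /andP[].
rewrite Es; apply: (packs_fan _ pk us vs); rewrite -?Es //.
- exact: leq_trans dk.
- move=> w; rewrite mem_enum inE => /andP[/hA [h1 h2] _].
  exact: leq_trans h2 h1.
- apply: leq_trans (leq_mul (_ : d.+1 <= k.+1)%N (_ : j.+1 <= 3)%N) _ => //; lia.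
Qed.

Lemma sum_deg_few (B : {set V}) (j : nat) :
  {in B, forall v, (deg_in G B v <= k)%N} -> 
  (#|[set w in B | (j.+1 <= deg_in G B w)%N]| <= few_size)%N ->
  \sum_(w in B) (deg_in G B w)%:R * x w
    <= j%:R * \sum_(w in B) x w + (k * few_size)%:R.
Proof.
move=> Bk few.
apply: (@le_trans _ _ (\sum_(w in B) (j%:R * x w
    + if (j.+1 <= deg_in G B w)%N then k%:R else 0))).
  apply: ler_sum => w wB; have x0 := (x_ge0 x01) w; have x1 := (x_le1 x01) w.
  case: ltnP => [lt|le]; last by rewrite addr0 ler_wpM2r // ler_nat.
  apply: (@le_trans _ _ k%:R); last by rewrite lerDr mulr_ge0.
  apply: le_trans (ler_piMr _ x1) _ => //; rewrite ler_nat; exact: Bk.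
rewrite big_split /= -mulr_sumr lerD2l -big_mkcondr sumr_const -[k%:R *+ _]mulr_natr -natrM.
rewrite ler_nat leq_mul2l; apply/orP; right; apply: leq_trans few.
by apply/subset_leq_card/subsetP => w; rewrite !inE.
Qed.

Lemma sum_deg_max (B : {set V}) (s : nat) :
  {in B, forall v, (deg_in G B v <= s)%N} ->
  \sum_(w in B) (deg_in G B w)%:R * x w <= s%:R * \sum_(w in B) x w.
Proof.
move=> Bs; rewrite mulr_sumr; apply: ler_sum => w wB.
by apply: ler_wpM2r; [apply: (x_ge0 x01) | rewrite ler_nat Bs].
Qed.

Lemma side_sum (A : {set V}) : r * \sum_(v in A) x v
  <= \sum_(v in A) (deg_in G A v)%:R * x v + #|A|%:R * \sum_(v in ~: A) x v.
Proof.
rewrite (eig_sum eig) lerD2l mulr_sumr; apply: ler_sum => w _.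
apply: ler_wpM2r; first exact: (x_ge0 x01).
by rewrite ler_nat; apply/subset_leq_card/subsetP => z; rewrite inE => /andP[].
Qed.

Lemma n_quarter (A : {set V}) : (#|A| * #|~: A| <= #|V| ^ 2 %/ 4)%N.
Proof.
rewrite leq_divRL // -(cardsC A); move: #|A| #|~: A|; clear=> a b.
by case: (leqP a b) => /subnKC; move: (_ - _)%N => c <-; lia.
Qed.

Lemma r_prod (A : {set V}) : #|A|%:R * #|~: A|%:R - (odd k)%:R <= r ^+ 2 - k%:R * r.
Proof.
by apply: le_trans rquad; rewrite lerD2r -natrM ler_nat n_quarter.
Qed.

Lemma sum_ge_half (A : {set V}) : #|A|%:R <= 2%:R * \sum_(v in A) x v.
Proof.
rewrite mulr_sumr -sum1_card natr_sum; apply: ler_sum => v _; exact: xhalf.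
Qed.

Lemma sum_le_card (A : {set V}) : \sum_(v in A) x v <= #|A|%:R.
Proof.
rewrite -sum1_card natr_sum; apply: ler_sum => v _; exact: (x_le1 x01).
Qed.

Lemma r_large : (2 * k + 5)%:R <= r.
Proof.
have [+ _ _] : [/\ 2 * (2 * k + 5) <= #|V|, 12 * (k * few_size) < #|V|
    & k.+1 ^ k * (avoidable_size + 4 * (k * few_size + 1)) < #|V|]%N.
  by apply: side_threshold_bounds nlarge _; apply: leq_pmull.
by rewrite -(ler_nat R) natrM; have := rlow; lra.
Qed.

(** Up to bounded errors, [side_sum] gives [(r - p) * (r - q) * X <= #|A| * #|~: A| * X], where [X]
    is the weight of [A]. As [p + q < k], comparing with [r^2 - k * r] leaves [X] bounded, against
    [X >= #|A| / 2]. *)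
Lemma no_small (A : {set V}) (p q : nat) : balanced A -> (p + q < k)%N ->
  \sum_(v in A) (deg_in G A v)%:R * x v <= p%:R * \sum_(v in A) x v + (k * few_size)%:R ->
  \sum_(v in ~: A) (deg_in G (~: A) v)%:R * x v
    <= q%:R * \sum_(v in ~: A) x v + (k * few_size)%:R -> False.
Proof.
move=> [cA _ _] pq HA HB.
have := side_sum A; have := side_sum (~: A); rewrite setCK => sB sA.
have rp := r_prod A; have rl := r_large; rewrite natrD natrM in rl.
have X1 := sum_ge_half A.
have an : #|A|%:R <= 2%:R * r.
  by apply: le_trans rlow; rewrite ler_nat max_card.
have n8 : 12%:R * (k * few_size)%:R < #|A|%:R :> R.
  by rewrite -natrM ltr_nat; have [] := side_threshold_bounds nlarge cA.
move: HA HB sA sB rp X1 an n8 rl; set X := \sum_(v in A) x v.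
set Y := \sum_(v in ~: A) x v.
set DA := \sum_(v in A) _; set DB := \sum_(v in ~: A) _.
have ok : (odd k)%:R <= 1 :> R by rewrite lern1 leq_b1.
have pqk : p%:R + q%:R + 1 <= k%:R :> R by rewrite -natrD natr1 ler_nat.
have p0 : 0 <= p%:R :> R by [].
have q0 : 0 <= q%:R :> R by [].
have k1 : 1 <= k%:R :> R by rewrite ler1n.
have b0 : 0 <= #|~: A|%:R :> R by [].
have a0 : 0 <= #|A|%:R :> R by [].
have c0 : 0 <= (k * few_size)%:R :> R by [].
move: p%:R q%:R k%:R (odd k)%:R p0 q0 k1 ok pqk #|A|%:R #|~: A|%:R a0 b0 (k * few_size)%:R c0.
move=> p' q' k' o p0 q0 k1 o1 pqk a b a0 b0 c c0 HA HB sA sB rp X1 an n8 rl.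
have E1 : (r - p') * X <= a * Y + c by lra.
have E2 : (r - q') * Y <= b * X + c by lra.
have rq : 0 <= r - q' by lra.
have E3 : (r - q') * ((r - p') * X) <= (r - q') * (a * Y + c) by apply: ler_wpM2l.
have E4 : a * ((r - q') * Y) <= a * (b * X + c) by apply: ler_wpM2l.
have X0 : 0 <= X by lra.
have r0 : 0 <= r by lra.
have E5 : 0 <= (r ^+ 2 - k' * r - a * b + 1) * X by apply: mulr_ge0; lra.
have E6 : 0 <= (k' - p' - q' - 1) * (r * X) by apply: mulr_ge0; [lra|exact: mulr_ge0].
have E7 : 0 <= p' * q' * X by rewrite !mulr_ge0.
have E8 : 0 <= (2%:R * r - a) * c by apply: mulr_ge0; lra.
have E9 : 0 <= q' * c by apply: mulr_ge0.
have F : (r - 1) * X <= 3%:R * (r * c) by lra.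
have F2 : r * X <= 6%:R * (r * c).
  have : 0 <= (r - 2%:R) * X by apply: mulr_ge0; lra.
  by lra.
have F3 : X <= 6%:R * c by rewrite -(ler_pM2l (x := r)); lra.
lra.
Qed.

(** If few vertices of [~: A] have inner neighbours, the weighted deficiency of [A] is bounded. So
    [A] is [k]-regular up to boundedly many vertices and packs paths on [k.+1] vertices. *)
Lemma few_edges (A : {set V}) (u w : V) : balanced A ->
  u \in ~: A -> w \in ~: A -> G u w ->
  (#|[set v in ~: A | (0 < deg_in G (~: A) v)%N]| <= few_size)%N -> False.
Proof.
move=> [cA hA hB] uB wB uw few.
have {}few := @sum_deg_few (~: A) 0 _ few; rewrite mul0r add0r in few.
have {}few : \sum_(v in ~: A) (deg_in G (~: A) v)%:R * x v <= (k * few_size)%:R.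
  by apply: few => v /hB [].
pose low := [set v in A | (deg_in G A v < k)%N].
have clow : (#|low| <= 4 * (k * few_size + 1))%N.
  pose W := \sum_(v in A) (k%:R - (deg_in G A v)%:R) * x v.
  have lW : #|low|%:R <= 2%:R * W.
    rewrite -sum1_card natr_sum /W mulr_sumr.
    apply: (@le_trans _ _ (\sum_(v in low) 2%:R * ((k%:R - (deg_in G A v)%:R) * x v))).
      apply: ler_sum => v; rewrite inE => /andP[_]; rewrite -(ler_nat R) -natr1.
      move=> h; rewrite mulrCA; have := xhalf v => h'.
      by rewrite -[leLHS]mulr1; apply: ler_pM => //; lra.
    rewrite [X in _ <= X](bigID (mem low)) /= -[leLHS]addr0; apply: lerD.
      rewrite le_eqVlt; apply/orP; left; apply/eqP; apply: eq_bigl => v.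
      by rewrite !inE; case: (v \in A).
    apply: sumr_ge0 => v /andP[/hA [dk _] _]; rewrite !mulr_ge0 ?(x_ge0 x01) //.
    by rewrite subr_ge0 ler_nat.
  rewrite -(ler_nat R) !natrM natrD natrM; apply: le_trans lW _.
  have := side_sum A; have := side_sum (~: A); rewrite setCK => sB sA.
  have rp := r_prod A; have rl := r_large; rewrite natrD natrM in rl.
  have an : #|A|%:R <= 2%:R * r by apply: le_trans rlow; rewrite ler_nat max_card.
  have Xa := sum_le_card A.
  have X0 : 0 <= \sum_(v in A) x v by apply: sumr_ge0 => v _; apply: (x_ge0 x01).
  have WE : W = k%:R * \sum_(v in A) x v - \sum_(v in A) (deg_in G A v)%:R * x v.
    by rewrite mulr_sumr -sumrB; apply: eq_bigr => v _; ring.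
  move: few sA sB rp an Xa X0 WE rl; rewrite natrM.
  set X := \sum_(v in A) x v; set Y := \sum_(v in ~: A) x v.
  set DA := \sum_(v in A) _; set DB := \sum_(v in ~: A) _.
  have ok : (odd k)%:R <= 1 :> R by rewrite lern1 leq_b1.
  have k1 : 1 <= k%:R :> R by rewrite ler1n.
  have a0 : 0 <= #|A|%:R :> R by [].
  have M00 : 0 <= few_size%:R :> R by [].
  move: #|A|%:R a0 #|~: A|%:R few_size%:R M00 k%:R (odd k)%:R k1 ok.
  move=> a a0 b m m0 k' o k1 o1 few sA sB rp an Xa X0 WE rl.
  have km : 0 <= k' * m by apply: mulr_ge0; lra.
  have r0 : 0 < r by lra.
  have E1 : r * (r * X) <= r * (DA + a * Y) by apply: ler_wpM2l => //; lra.
  have E2 : a * (r * Y) <= a * (DB + b * X) by apply: ler_wpM2l.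
  have E3 : a * DB <= a * (k' * m) by apply: ler_wpM2l.
  have E4 : 0 <= (r ^+ 2 - k' * r - a * b + 1) * X by apply: mulr_ge0; lra.
  have E5 : 0 <= (2%:R * r - a) * (k' * m + 1) by apply: mulr_ge0; lra.
  have F : r * W <= r * (2%:R * (k' * m + 1)) by rewrite WE; lra.
  by move: F; rewrite ler_pM2l //; lra.
have pk : packs G A k.+1 avoidable_size.
  apply: packs_path => [v /hA []//|].
  have [_ _] := side_threshold_bounds nlarge cA; apply: leq_ltn_trans.
  by rewrite leq_mul2l leq_add2l clow orbT.
have [d1 m1] := hB u uB; have [d2 m2] := hB w wB.
(* Centre [u], and a rim of two paths on [k.+1] vertices joined through [w]: [2 * k + 3]
   vertices. *)
have := @packs_fan A k.+1 u [:: w] (ltn0Sn k) pk isT.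
rewrite /= uw; move=> /(_ isT (leq_trans m1 d1)) H.
have : (1 + 2 * k.+1 <= 2 * k + 2)%N.
  apply: H => //; last by lia.
  by move=> a; rewrite inE => /eqP ->; apply: leq_trans m2 d2.
by lia.
Qed.

Lemma large_degree_set (A : {set V}) (u w : V) : balanced A ->
  u \in ~: A -> w \in ~: A -> G u w ->
  (few_size < #|[set v in ~: A | (0 < deg_in G (~: A) v)%N]|)%N.
Proof.
by move=> bA uA wA uw; rewrite ltnNge; apply/negP; apply: few_edges uw.
Qed.

(** As [s + t = k], the inequality [(r - s) * (r - t) <= #|A| * #|~: A|] reads
    [r^2 - k * r + s * t <= #|A| * #|~: A|], and [r_prod] leaves room for [odd k] only. *)
Lemma product_bound (A : {set V}) (s t : nat) : balanced A -> (s + t = k)%N ->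
  {in A, forall v, (deg_in G A v <= s)%N} ->
  {in ~: A, forall v, (deg_in G (~: A) v <= t)%N} -> (s * t <= odd k)%N.
Proof.
move=> [cA _ _] st /sum_deg_max HA /sum_deg_max HB.
have := side_sum A; have := side_sum (~: A); rewrite setCK => sB sA.
have rp := r_prod A; have rl := r_large; rewrite natrD natrM in rl.
have X1 := sum_ge_half A.
have A1 : 1 <= #|A|%:R :> R.
  by rewrite ler1n; have [_ + _] := side_threshold_bounds nlarge cA; apply: leq_trans.
rewrite -(ler_nat R) natrM.
have stR : s%:R + t%:R = k%:R :> R by rewrite -natrD st.
have s0 : 0 <= s%:R :> R by [].
have t0 : 0 <= t%:R :> R by [].
have a0 : 0 <= #|A|%:R :> R by [].
move: HA HB sA sB rp X1; set X := \sum_(v in A) x v.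
set Y := \sum_(v in ~: A) x v.
set DA := \sum_(v in A) _; set DB := \sum_(v in ~: A) _.
move: #|A|%:R a0 A1 #|~: A|%:R s%:R t%:R (odd k)%:R k%:R s0 t0 stR rl.
move=> a a0 a1 b s' t' o k' s0 t0 stR rl HA HB sA sB rp X1.
have E1 : (r - t') * ((r - s') * X) <= (r - t') * (a * Y).
  by apply: ler_wpM2l; lra.
have E2 : a * ((r - t') * Y) <= a * (b * X) by apply: ler_wpM2l => //; lra.
have E3 : 0 <= (r ^+ 2 - k' * r - a * b + o) * X by apply: mulr_ge0; lra.
have X0 : 0 < X by lra.
rewrite -(ler_pM2r X0) -stR in E3 *; lra.
Qed.

Lemma edgeless_side (A : {set V}) (u w u' w' : V) :
  balanced A -> balanced (~: A) -> u \in A -> w \in A -> G u w ->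
  u' \in ~: A -> w' \in ~: A -> G u' w' -> False.
Proof.
move=> bA bB uA wA uw u'A w'A uw'.
have B1 := large_degree_set bA u'A w'A uw'.
have A1 : (few_size < #|[set v in ~: ~: A | (0 < deg_in G (~: ~: A) v)%N]|)%N.
  by apply: (large_degree_set bB) uw; rewrite setCK.
have pos (S : {set V}) a b : a \in S -> b \in S -> G a b -> (0 < deg_in G S a)%N.
  by move=> aS bS ab; apply/card_gt0P; exists b; rewrite inE bS.
have [|v vA smax] := @eq_bigmax_cond _ (mem A) (deg_in G A).
  by apply/card_gt0P; exists u.
have [|v' v'A tmax] := @eq_bigmax_cond _ (mem (~: A)) (deg_in G (~: A)).
  by apply/card_gt0P; exists u'.
set s := \max_(i in _) _ in smax; set t := \max_(i in _) _ in tmax.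
have As : {in A, forall z, (deg_in G A z <= s)%N}.
  by move=> z zA; apply: (leq_bigmax_cond (F := deg_in G A)).
have Bt : {in ~: A, forall z, (deg_in G (~: A) z <= t)%N}.
  by move=> z zA; apply: (leq_bigmax_cond (F := deg_in G (~: A))).
have s0 : (0 < s)%N by apply: leq_trans (As u uA); apply: pos uw.
have t0 : (0 < t)%N by apply: leq_trans (Bt u' u'A); apply: pos uw'.
have v'AC : v' \in ~: A by [].
have pA (j : nat) := @balanced_pack_bound A j v bA vA.
have pB (j : nat) := @balanced_pack_bound (~: A) j v' bB v'AC.
rewrite -smax in pA; rewrite -tmax in pB.
have s3 := pA 1 isT B1; have t3 := pB 1 isT A1.
have DA := sum_deg_max As; have DB := sum_deg_max Bt.
have kM0 : 0 <= (k * few_size)%:R :> R by [].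
have DA' : \sum_(z in A) (deg_in G A z)%:R * x z
    <= s%:R * \sum_(z in A) x z + (k * few_size)%:R by apply: le_trans DA _; rewrite lerDl.
have DB' : \sum_(z in ~: A) (deg_in G (~: A) z)%:R * x z
    <= t%:R * \sum_(z in ~: A) x z + (k * few_size)%:R.
  by apply: le_trans DB _; rewrite lerDl.
have lst : (k <= s + t)%N.
  by rewrite leqNgt; apply/negP => lt; apply: (no_small bA lt DA' DB').
have ex : (s + t = k)%N -> (s * t <= odd k)%N by move=> e; apply: product_bound e As Bt.
have [_ hA hB] := bA.
have hA' : {in A, forall z, (deg_in G A z <= k)%N} by move=> z /hA [].
have hB' : {in ~: A, forall z, (deg_in G (~: A) z <= k)%N} by move=> z /hB [].
have D2 := @sum_deg_few A 1 hA'; have E2 := @sum_deg_few (~: A) 1 hB'.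
have {pA} s4 : (few_size < #|[set w in ~: A | (2 <= deg_in G (~: A) w)%N]|)%N ->
  (s + s.+1 * 3 <= 2 * k + 2)%N by apply: pA.
have {pB} t4 : (few_size < #|[set w in A | (2 <= deg_in G A w)%N]|)%N ->
  (t + t.+1 * 3 <= 2 * k + 2)%N by have := pB 2 isT; rewrite setCK.
(* The cases are whether each side has few or many vertices of inner degree at least 2. Few on a
   side replace its maximal degree by 1 in [no_small]; many pack paths on three vertices and sharpen
   the bound on the other side's maximal degree. *)
case: leqP D2 t4 => [_ /(_ isT) DA1 _|_ _ /(_ isT) t4];
  case: leqP E2 s4 => [_ /(_ isT) DB1 _|_ _ /(_ isT) s4].
- case: (ltnP (1 + 1) k) => k2; first exact: (no_small bA k2 DA1 DB1).
  have s1 : s = 1%N by move: s3 t3 lst s0 t0 k2; clear; lia.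
  have t1 : t = 1%N by move: s3 t3 lst s0 t0 k2; clear; lia.
  have k2' : k = 2%N by move: s3 t3 lst s0 t0 k2; clear; lia.
  by move: ex; rewrite s1 t1 k2' => /(_ erefl).
- case: (ltnP (1 + t) k) => k2; first exact: (no_small bA k2 DA1 DB').
  have k3 : k = 3%N by move: s4 s3 t3 lst s0 t0 k2; clear; lia.
  have s1 : s = 1%N by move: s4 s3 t3 lst s0 t0 k2; clear; lia.
  have t1 : t = 2%N by move: s4 s3 t3 lst s0 t0 k2; clear; lia.
  by move: ex; rewrite s1 t1 k3 => /(_ erefl).
- case: (ltnP (s + 1) k) => k2; first exact: (no_small bA k2 DA' DB1).
  have k3 : k = 3%N by move: t4 s3 t3 lst s0 t0 k2; clear; lia.
  have s1 : s = 2%N by move: t4 s3 t3 lst s0 t0 k2; clear; lia.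
  have t1 : t = 1%N by move: t4 s3 t3 lst s0 t0 k2; clear; lia.
  by move: ex; rewrite s1 t1 k3 => /(_ erefl).
(* Here [4 * s <= 2 * k - 1] and [4 * t <= 2 * k - 1], so [s + t < k]. *)
- by move: s4 t4 lst s0 t0; clear; lia.
Qed.
End OneSide.

(** * Degrees and part sizes *)

(** Removing [u] lowers the degree sum by twice the degree of [u]. *)
Lemma handshake (V : finType) (G : sgraph V) (S : {set V}) :
  ~~ odd (\sum_(v in S) deg_in G S v).
Proof.
have [n] := ubnP #|S|; elim: n S => // n IH S Sn.
have [->|[u uS]] := set_0Vmem S; first by rewrite big_set0.
rewrite (big_setD1 u uS) /=.
rewrite (eq_bigr (fun w => G u w + deg_in G (S :\ u) w)); last first.
  by move=> w wS; rewrite (deg_inD1 _ _ uS) adj_sym.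
rewrite big_split /= sum_adj (deg_inD1 _ _ uS) adj_irr add0n addnA addnn.
rewrite oddD odd_double /=; apply: IH.
by move: Sn; rewrite (cardsD1 u S) uS.
Qed.

Lemma degree_induced (V : finType) (G : sgraph V) (L : {set V})
    (v : {v : V | v \in L}) : degree (induced G L) v = deg_in G L (val v).
Proof.
rewrite /degree -(card_imset _ val_inj); apply: eq_card => w.
rewrite inE; apply/imsetP/andP => [[z + ->]|[wL vw]].
  by rewrite inE => vz; split=> //; apply: valP.
by exists (Sub w wL); rewrite ?inE.
Qed.

Lemma balanced_product (a b n : nat) : a + b = n -> n ^ 2 %/ 4 <= a * b ->
  a <= b.+1 /\ b <= a.+1.
Proof.
move=> <- H; split; rewrite leqNgt; apply/negP => lt.
  have [c ac] : exists c, a = b + c.+2 by exists (a - b - 2); lia.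
  by move: H; rewrite ac; lia.
have [c ac] : exists c, b = a + c.+2 by exists (b - a - 2); lia.
by move: H; rewrite ac; lia.
Qed.

Lemma near_balanced_product (a b n : nat) : a + b = n ->
  n ^ 2 %/ 4 <= (a * b).+1 -> a <= b.+2 /\ b <= a.+2.
Proof.
move=> <- H; split; rewrite leqNgt; apply/negP => lt.
  have [c ac] : exists c, a = b + c.+3 by exists (a - b - 3); lia.
  by move: H; rewrite ac; lia.
have [c ac] : exists c, b = a + c.+3 by exists (b - a - 3); lia.
by move: H; rewrite ac; lia.
Qed.

(** * Lower bounds for extremal graphs *)

Section SpexLower.
Import Order.TTheory GRing.Theory Num.Theory.
Local Open Scope ring_scope.
Variable R : realType.

(** The hypothesis on [s] says [s >= k], and beyond [k] the quadratic increases. *)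
Lemma quadratic_mono (k : nat) (s t : R) : 0 < s -> 0 <= s ^+ 2 - k%:R * s ->
  s <= t -> s ^+ 2 - k%:R * s <= t ^+ 2 - k%:R * t.
Proof.
move=> s0; have -> : s ^+ 2 - k%:R * s = s * (s - k%:R) by ring.
rewrite pmulr_rge0 // => sk st; rewrite -subr_ge0.
have -> : t ^+ 2 - k%:R * t - s * (s - k%:R) = (t - s) * (s + (t - k%:R)) by ring.
by apply: mulr_ge0; lra.
Qed.

Lemma spex_lower (k n a b : nat) (G : sgraph 'I_n) : (0 < k)%N -> (a + b = n)%N ->
  (0 < b)%N -> (2 * k * k.+1 < a)%N -> ~~ odd (k * a) ->
  SPEX R (fan (2 * k + 3)) G ->
  0 < spectral_radius R G /\
  a%:R * b%:R <= spectral_radius R G ^+ 2 - k%:R * spectral_radius R G.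
Proof.
move=> k0 ab b0 ak ev; case: n / ab G => G [_ Gmax].
have [G0 [/Gmax le r0 E]] := spex_lower_regular R k0 b0 ak ev.
split; first exact: lt_le_trans le.
by rewrite -E; apply: quadratic_mono => //; rewrite E mulr_ge0.
Qed.

Lemma spex_lower1 (n a : nat) (G : sgraph 'I_n) : (a + a = n)%N ->
  (4 < a)%N -> odd a -> SPEX R (fan (2 * 1 + 3)) G ->
  0 < spectral_radius R G /\
  a%:R ^+ 2 - 1 < spectral_radius R G ^+ 2 - spectral_radius R G.
Proof.
move=> aa a4 oa; case: n / aa G => G [_ Gmax].
have [G0 [/Gmax le r0 lt]] := spex_lower_matching R a4 oa.
split; first exact: lt_le_trans le.
apply: (lt_le_trans lt); have := @quadratic_mono 1 _ _ r0 _ le.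
rewrite !mul1r; apply.
have a1 : 1 <= a%:R :> R by rewrite ler1n; apply: leq_trans a4.
by apply: ltW; apply: le_lt_trans lt; rewrite subr_ge0 expr_ge1 //; lra.
Qed.
End SpexLower.

(** * Deficiency from regularity *)

Section Defect.
Variables (V : finType) (G : sgraph V) (k : nat) (L : {set V}).

Definition defect := (\sum_(v in L) (k - deg_in G L v))%N.
Hypothesis degL : {in L, forall v, deg_in G L v <= k}.

Lemma defect_parity : odd defect = odd (k * #|L|).
Proof.
have <- : (defect + \sum_(v in L) deg_in G L v = k * #|L|)%N.
  rewrite -big_split /= mulnC -sum_nat_const; apply: eq_bigr => v vL.
  by rewrite subnK // degL.
by rewrite oddD (negPf (handshake G L)) addbF.
Qed.

Lemma defect0 : defect = 0%N -> {in L, forall v, deg_in G L v = k}.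
Proof.
move=> /eqP; rewrite sum_nat_eq0 => /forall_inP H v vL.
by apply/eqP; rewrite eqn_leq degL //= -subn_eq0 H.
Qed.

Lemma defect1 : defect = 1%N -> exists2 v, v \in L
  & (deg_in G L v = k.-1 /\ {in L, forall u, u != v -> deg_in G L u = k}) /\ (0 < k)%N.
Proof.
move=> D1.
have /existsP [v /andP[vL dv]] : [exists v, (v \in L) && (deg_in G L v < k)%N].
  apply: contraT => /existsPn H; suff : defect = 0%N by rewrite D1.
  apply: big1 => v vL; apply/eqP; rewrite subn_eq0 leqNgt.
  by have := H v; rewrite vL.
exists v => //; move: D1; rewrite /defect (bigD1 v) //= => D1; split; last by lia.
have S0 : (\sum_(i in L | i != v) (k - deg_in G L i) = 0)%N by lia.
split; first by lia.
move=> u uL uv; move/eqP: S0; rewrite sum_nat_eq0 => /forall_inP /(_ u).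
rewrite uL uv => /(_ isT); rewrite subn_eq0 => h.
by apply/eqP; rewrite eqn_leq degL.
Qed.

End Defect.

Section FinalShape.
Import Order.TTheory GRing.Theory Num.Theory.
Local Open Scope ring_scope.
Variables (R : realType) (V : finType) (G : sgraph V) (x : V -> R) (r : R).
Variables (k : nat) (L : {set V}).
Hypothesis eig : forall v, nsum G x v = r * x v.
Hypothesis x01 : forall v, 0 <= x v <= 1.
Hypothesis xhalf : forall v, 1 <= 2%:R * x v.
Hypothesis r_gt0 : 0 < r.
Hypothesis bip : bipartite_with_embedding G L.
Hypothesis degL : {in L, forall v, (deg_in G L v <= k)%N}.
Hypothesis R_gt0 : (0 < #|~: L|)%N.

Local Notation defect := (defect G k L).

Local Notation q := (r ^+ 2 - k%:R * r).
Local Notation ab := (#|L|%:R * #|~: L|%:R).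
Local Notation W := (\sum_(v in L) (k%:R - (deg_in G L v)%:R) * x v).

Lemma defect_weight : 0 <= W /\ defect%:R <= 2%:R * W.
Proof.
have k0 v : v \in L -> 0 <= k%:R - (deg_in G L v)%:R :> R.
  by move=> vL; rewrite subr_ge0 ler_nat degL.
split; first by apply: sumr_ge0 => v vL; rewrite mulr_ge0 ?k0 //; case/andP: (x01 v).
rewrite mulr_sumr natr_sum; apply: ler_sum => v vL.
rewrite natrB ?degL // mulrCA -[leLHS]mulr1.
by apply: ler_wpM2l; [apply: k0 | apply: xhalf].
Qed.

(** Outside [L] all vertices satisfy [r * x w = X], with [X] the weight of [L], so
    [embedding_identity] can be divided by [r]. *)
Lemma defect_value (w : V) : w \notin L -> (ab - q) * x w = W.
Proof.
move=> wL; have := embedding_identity eig k bip.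
rewrite -(embedding_value eig bip wL) => E.
apply: (mulfI (x := r)); first by rewrite gt_eqF.
have : r * ((ab - q) * x w) = - ((q - ab) * (r * x w)) by ring.
by rewrite E => ->; rewrite opprK.
Qed.

Lemma some_right : exists w, w \notin L.
Proof. by have /card_gt0P [w] := R_gt0; rewrite inE; exists w. Qed.

Lemma q_le_ab : q <= ab.
Proof.
have [w wL] := some_right; have := defect_value wL; have [W0 _] := defect_weight.
have := xhalf w => h E; rewrite -subr_ge0 -(pmulr_lge0 (x := x w)); last by lra.
by rewrite E.
Qed.

(** The loss is at most [c] and each unit of deficiency has weight at least 1/2; this is where the
    factor 2 comes from. *)
Lemma defect_le (c : nat) : ab - c%:R <= q -> (defect <= 2 * c)%N.
Proof.
have [w wL] := some_right; have := defect_value wL; have [W0 WD] := defect_weight.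
move=> E H; rewrite -(ler_nat R) natrM; apply: le_trans WD _.
rewrite ler_pM2l // -E; have /andP[x0 x1] := x01 w.
apply: (@le_trans _ _ (c%:R * x w)); first by apply: ler_wpM2r; lra.
by rewrite ler_piMr.
Qed.

(* If [k >= 3] and the parts are equal, the deficient vertex would weigh more
   than the vertices of the other part, so that the loss exceeds [1]. *)
Lemma defect1_exclude : (3 <= k)%N -> #|L| = #|~: L| -> (2 * k ^ 2 < #|L|)%N ->
  ab - 1 <= q -> (#|L| + #|L|)%:R <= 2%:R * r -> defect = 1%N -> False.
Proof.
move=> k3 Lab kL H rl D1.
have [v vL [[dv dL] k0]] := defect1 degL D1.
have [w wL] := some_right; have qab := q_le_ab.
have W1 : W = x v.
  rewrite (bigD1 v) //= big1 ?addr0.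
    rewrite dv -{1}(prednK k0) -natr1 addrAC subrr add0r mul1r //.
  by move=> u /andP[uL uv]; rewrite dL // subrr mul0r.
have := defect_value wL; rewrite W1 => xv.
have /andP[xw0 xw1] := x01 w; have xh := xhalf w.
(* A loss of at most 1 makes the deficient vertex no heavier than those of the other part. Its
   [k.-1] neighbours in [L] contradict this below. *)
have xvw : x v <= x w by rewrite -xv ler_piMl //; lra.
have Ysum : \sum_(z in ~: L) x z = #|L|%:R * x w.
  apply: (mulfI (x := r)); first by rewrite gt_eqF.
  by rewrite (embedding_sumR eig bip) -(embedding_value eig bip wL) -Lab; ring.
have rxu u : u \in L -> #|L|%:R * x w <= r * x u.
  move=> uL; rewrite -eig -Ysum /nsum.
  rewrite [X in _ <= X](bigID (mem (~: L))) /= -[leLHS]addr0; apply: lerD.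
    rewrite le_eqVlt; apply/orP; left; apply/eqP; apply: eq_bigl => z.
    by rewrite inE; case: (boolP (z \in L)) => zL; rewrite ?andbF // bip ?(negPf zL) ?andbF // uL.
  by apply: sumr_ge0 => z _; case/andP: (x01 z).
have rxv : r * (r * x v) >= r * (#|L|%:R * x w) + (k.-1)%:R * (#|L|%:R * x w).
  have -> : r * x v = #|L|%:R * x w + \sum_(z in [set z in L | G v z]) x z.
    rewrite -eig -Ysum /nsum (bigID (mem (~: L))) /=; congr (_ + _).
      apply: eq_bigl => z; rewrite inE.
      by case: (boolP (z \in L)) => zL; rewrite ?andbF // bip ?(negPf zL) ?andbF // vL.
    by apply: eq_bigl => z; rewrite !inE negbK andbC.
  rewrite mulrDr lerD2l mulr_sumr mulr_natl -dv /deg_in -[(_ * _) *+ _]sumr_const.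
  by apply: ler_sum => z; rewrite inE => /andP[/rxu].
have rr : r * (r * x v) <= r * (r * x w).
  by rewrite !ler_pM2l.
have xw : 0 < x w by lra.
have F : r * #|L|%:R + (k.-1)%:R * #|L|%:R <= r ^+ 2.
  by rewrite -(ler_pM2r xw); lra.
move: F qab rl kL; rewrite -(ltr_nat R) natrM natrX natrD -Lab.
have k3R : 3%:R <= k%:R :> R by rewrite ler_nat.
have -> : (k.-1)%:R = k%:R - 1 :> R by rewrite -(natrB _ k0) subn1.
move: #|L|%:R k%:R k3R => b k' k3R F qab rl kb.
(* If [r - b <= k], the two bounds on [r ^+ 2] combine to [(k - 2) * b <= 2 * k ^ 2], too small for
   [b]; otherwise [r^2 - b^2] already exceeds [k * r]. *)
have [tk|tk] := lerP (r - b) k'.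
  have t0 : 0 <= r - b by lra.
  have : (r - b) ^+ 2 <= k' ^+ 2 by rewrite ler_pXn2r ?nnegrE //; lra.
  have : 0 <= (k' - (r - b)) * k' by apply: mulr_ge0; lra.
  have : 0 <= (k' - 3%:R) * b by apply: mulr_ge0; nra.
  by lra.
have : 0 < (r - b - k') * (r + b) by apply: mulr_gt0; nra.
have : 0 <= k' * b by apply: mulr_ge0; nra.
by lra.
Qed.
End FinalShape.

(** * Arithmetic of the part sizes and the shape of the embedding *)

Definition exceptional (k n : nat) : bool := odd k && (n %% 4 == 2).

(** For odd [k] the part [a] must be even. When [n] is 2 modulo 4 both halves are odd, so the parts
    differ by 2 and the product falls short of the maximum by 1. *)
Lemma part_choice (k n : nat) : 4 * k * k.+1 + 8 <= n ->
  exists a b, [/\ a + b = n, 0 < b, 2 * k * k.+1 < a, ~~ odd (k * a)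
    & n ^ 2 %/ 4 <= a * b + exceptional k n].
Proof.
rewrite /exceptional; move: (k * k.+1) => kk.
have [ok|ek] := boolP (odd k); last first.
  rewrite -!mulnA; move=> H; exists (n %/ 2), (n - n %/ 2).
  rewrite oddM (negPf ek); split=> //; try by lia.
  have [m [e [nE e1]]] : exists m e, n = 2 * m + e /\ e <= 1.
    by exists (n %/ 2), (n %% 2); lia.
  have -> : n %/ 2 = m by lia.
  have -> : n - m = m + e by lia.
  by case: e e1 nE => [|[|]] // _ ->; lia.
rewrite -!mulnA => H.
have [m [e [nE e1]]] : exists m e, n = 4 * m + e /\ e <= 3.
  by exists (n %/ 4), (n %% 4); lia.
case: e e1 nE => [|[|[|[|]]]] // _ nE.
- by exists (2 * m), (2 * m); split; rewrite ?oddM ?ok; lia.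
- by exists (2 * m), (2 * m + 1); split; rewrite ?oddM ?ok; lia.
- exists (2 * m), (2 * m + 2).
  have -> : (n %% 4 == 2) = true by lia.
  by split; rewrite ?oddM ?ok; lia.
- by exists (2 * m + 2), (2 * m + 1); split; rewrite ?oddM ?ok; lia.
Qed.

Lemma unbalanced_product (a b n : nat) : a + b = n -> n %% 4 == 2 -> a != b ->
  a * b + 1 <= n ^ 2 %/ 4.
Proof.
move=> <- n4 ab; rewrite leq_divRL //.
case: (leqP a b) => [/subnKC|/ltnW/subnKC]; move: (_ - _) => c E; subst.
  have : 2 <= c by lia.
  by case: c {n4 ab} => [|[|c]] // _; lia.
have : 2 <= c by lia.
by case: c {n4 ab} => [|[|c]] // _; lia.
Qed.

(** Any vertex outside [L] is joined to all of [L] and would be the centre of a fan. *)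
Lemma induced_path_free (V : finType) (G : sgraph V) (L : {set V}) (w : V)
    (l : nat) : bipartite_with_embedding G L -> w \notin L ->
  subgraph_free (fan l) G -> subgraph_free (path_graph l) (induced G L).
Proof.
move=> bip wL free /contains_pathP [p [sp up gp]]; apply/free/contains_fanP.
exists w, (map val p); split.
- by rewrite size_map.
- by rewrite map_inj_uniq //; apply: val_inj.
- by rewrite sorted_map.
- apply/allP => _ /mapP[v _ ->]; rewrite bip ?(negPf wL) //.
  by rewrite (valP v).
Qed.

(** A vertex outside [L] has no inner neighbours, hence by [balanced] misses no vertex of [L]. *)
Lemma edgeless_embedding (V : finType) (G : sgraph V) (k : nat) (L : {set V}) :
  balanced G k L -> {in ~: L &, forall u w, ~~ G u w} ->
  bipartite_with_embedding G L.
Proof.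
move=> [_ _ hB] free.
have cross w v : w \notin L -> v \in L -> G w v.
  move=> wL vL; have wB : w \in ~: L by rewrite inE.
  have [_] := hB w wB; have -> : deg_in G (~: L) w = 0.
    by apply: eq_card0 => z; rewrite inE; apply/negP => /andP[zB]; apply/negP/free.
  rewrite leqn0 cards_eq0 => /eqP/setP/(_ v).
  by rewrite !inE vL => /negbFE.
move=> x y; case: (boolP (x \in L)) => xL; case: (boolP (y \in L)) => yL //= _.
- by rewrite adj_sym cross.
- exact: cross.
- by apply/negbTE/free; rewrite inE.
Qed.

(** * Extremal graphs of large order *)

Section Main.
Import Order.TTheory GRing.Theory Num.Theory.
Local Open Scope ring_scope.
Variables (R : realType) (k : nat).
Hypothesis k_gt0 : (0 < k)%N.

Definition threshold := (8 * k * k.+1 + 12 + side_threshold k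
  + 100 * (4 * k + 6) * (1000 * (k + 2)) ^ 2)%N.

Section Spex.
Variables (n : nat) (G : sgraph 'I_n).
Hypothesis nbig : (threshold < n)%N.
Hypothesis spexG : SPEX R (fan (2 * k + 3)) G.
Local Notation r := (spectral_radius R G).

Lemma threshold_bounds : [/\ (8 * k * k.+1 + 12 < n)%N, (side_threshold k < n)%N
  & (100 * (4 * k + 6) * (1000 * (k + 2)) ^ 2 < n)%N].
Proof.
split; apply: leq_ltn_trans nbig; rewrite /threshold.
- by rewrite -addnA leq_addr.
- by rewrite -addnA addnCA leq_addr.
- by rewrite leq_addl.
Qed.

Lemma spex_quadratic : 0 < r /\
  (n ^ 2 %/ 4)%:R - (exceptional k n)%:R <= r ^+ 2 - k%:R * r.
Proof.
have [nk _ _] := threshold_bounds.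
have [|a [b [ab b0 ak ev H]]] := @part_choice k n; 
  first by move: nk; rewrite -!mulnA; move: (k * k.+1)%N => u; lia.
have [r0 q] := spex_lower k_gt0 ab b0 ak ev spexG; split=> //.
by apply: le_trans q; rewrite lerBlDr -natrM -natrD ler_nat.
Qed.

Lemma spex_radius_ge : n%:R <= 2%:R * r.
Proof.
have [r0 q] := spex_quadratic; have [nk _ _] := threshold_bounds.
have n4 : n%:R ^+ 2 <= 4%:R * (n ^ 2 %/ 4)%:R + 3%:R :> R.
  rewrite -natrX -natrM -natrD ler_nat.
  by have := divn_eq (n ^ 2) 4; have := ltn_pmod (n ^ 2) (isT : 0 < 4)%N; lia.
have o1 : (exceptional k n)%:R <= 1 :> R by rewrite lern1 leq_b1.
have k1 : 1 <= k%:R :> R by rewrite ler1n.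
have n12 : 12%:R <= n%:R :> R.
  by rewrite ler_nat; apply: leq_trans (ltnW nk); rewrite leq_addl.
rewrite leNgt; apply/negP => lt.
move: n4 o1 k1 n12 lt q r0; move: n%:R (n ^ 2 %/ 4)%:R (exceptional k n)%:R k%:R r.
move=> m f o k' s n4 o1 k1 n12 lt q s0.
have : 0 <= (k' - 1) * s by apply: mulr_ge0; lra.
have : 0 <= (m - 2%:R * s) * (m + 2%:R * s - 2%:R) by apply: mulr_ge0; lra.
by lra.
Qed.

(** By [edgeless_side] at most one of the two sides carries edges; the other one is taken as the
    complement of [L]. *)
Lemma spex_structure : exists (x : 'I_n -> R) (L : {set 'I_n}),
  [/\ [/\ forall v, nsum G x v = r * x v, forall v, 0 <= x v <= 1
        & forall v, 1 <= 2%:R * x v],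
      bipartite_with_embedding G L, {in L, forall v, (deg_in G L v <= k)%N},
      (n <= 4 * #|L|)%N & (n <= 4 * #|~: L|)%N].
Proof.
have [nk nN nD] := threshold_bounds; have [free _] := spexG.
have [|x [x01 xu eig]] := perron R G; first by apply: leq_trans nk.
have x0 v : 0 <= x v by case/andP: (x01 v).
have [|||A [xh [cA cB] hA hB]] := dense_structure eig x01 xu free.
- by rewrite card_ord spex_radius_ge.
- move=> v S vS H; apply: (spex_rejoin spexG x0 eig vS) => Z.
  by rewrite card_sum !card_ord => Zk; apply: H; lia.
- rewrite card_ord; apply: le_trans (_ : (100 * (4 * k + 6) * (1000 * (k + 2)) ^ 2)%:R <= _).
    by rewrite !(natrM, natrX, natrD).
  by rewrite ler_nat ltnW.
have rlow : #|'I_n|%:R <= 2%:R * r by rewrite card_ord spex_radius_ge.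
have rquad : (#|'I_n| ^ 2 %/ 4)%:R - (odd k)%:R <= r ^+ 2 - k%:R * r.
  have [_ q] := spex_quadratic; rewrite card_ord; apply: le_trans q.
  by rewrite lerD2l lerN2 ler_nat /exceptional; case: (odd k); rewrite ?leq_b1.
have nN' : (side_threshold k < #|'I_n|)%N by rewrite card_ord.
have bA : balanced G k A by split.
have bB : balanced G k (~: A) by split=> //; rewrite setCK.
rewrite card_ord in cA cB.
have [/existsP[u /existsP[w /and3P[uA wA uw]]]|noA] :=
    boolP [exists u, exists w, [&& u \in ~: A, w \in ~: A & G u w]].
  have free' : {in ~: ~: A &, forall u w, ~~ G u w}.
    rewrite setCK => u' w' u'A w'A; apply/negP => uw'.
    exact: (edgeless_side k_gt0 eig x01 xh free rlow rquad nN' bA bB u'A w'A uw' uA wA uw).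
  exists x, (~: A); split=> //; first exact: edgeless_embedding bB free'.
    by move=> v /hB [].
  by rewrite setCK.
exists x, A; split=> //; last by move=> v /hA [].
apply: (edgeless_embedding bA) => u w uA wA; apply: contra noA => uw.
by apply/existsP; exists u; apply/existsP; exists w; rewrite uA wA.
Qed.


(** The lower bound on [r] limits the sum of imbalance and deficiency. Only in the exceptional case
    is one unit available, to be spent either on unequal parts or on one deficient vertex. *)
Lemma spex_shape : exists L : {set 'I_n},
  [/\ bipartite_with_embedding G L, exists w, w \notin L
    & [/\ {in L, forall v, deg_in G L v = k}, ~~ odd (k * #|L|),
          (n ^ 2 %/ 4 <= #|L| * #|~: L| + exceptional k n)%N
        & k = 1%N -> (n ^ 2 %/ 4 <= #|L| * #|~: L|)%N]
      \/ [/\ k = 1%N, exceptional k n, #|L| = #|~: L| & exists2 v, v \in L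
            & deg_in G L v = k.-1 /\ {in L, forall u, u != v -> deg_in G L u = k}]].
Proof.
have [nk _ _] := threshold_bounds.
have [r0 q] := spex_quadratic.
have [x [L [[eig x01 xh] bip degL cL cR]]] := spex_structure.
have cLR : (#|L| + #|~: L| = n)%N by rewrite cardsC card_ord.
have R0 : (0 < #|~: L|)%N.
  by case: #|~: L| cR nk => // + nk; rewrite muln0 leqn0 => /eqP n0; rewrite n0 in nk.
exists L; have [w wL] := some_right R0; split=> //; first by exists w.
have qab := q_le_ab eig x01 xh r0 bip degL R0.
have ab_n := n_quarter L; rewrite card_ord in ab_n.
have ab_ge : (n ^ 2 %/ 4 <= #|L| * #|~: L| + exceptional k n)%N.
  by rewrite -(ler_nat R) natrD natrM -lerBlDr; apply: le_trans q qab.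
have ab_nR : #|L|%:R * #|~: L|%:R <= (n ^ 2 %/ 4)%:R :> R by rewrite -natrM ler_nat.
have par := defect_parity degL.
have [exc|nexc] := boolP (exceptional k n); last first.
  rewrite (negPf nexc) in ab_ge; rewrite (negPf nexc) /= subr0 in q.
  have D0 : defect G k L = 0%N.
    apply/eqP; rewrite -leqn0.
    by apply: (@defect_le _ _ _ _ _ _ _ eig x01 xh r0 bip degL R0 0); lra.
  left; split; [exact: defect0 | by rewrite -par D0 | exact: ab_ge |].
  by rewrite addn0 in ab_ge.
have [ok n4] := andP exc; rewrite exc in ab_ge; rewrite exc /= in q.
have [ab|ab] := eqVneq #|L| #|~: L|.
  right; have nE : n = (#|L| + #|L|)%N by rewrite {2}ab.
  have oL : odd #|L| by move: n4 nE; clear; lia.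
  have D1 : defect G k L = 1%N.
    (* The defect is at most 2, and odd because [k * #|L|] is odd. *)
    have : (defect G k L <= 2 * 1)%N.
      by apply: (@defect_le _ _ _ _ _ _ _ eig x01 xh r0 bip degL R0 1); lra.
    by move: par; rewrite oddM ok oL; case: (defect G k L) => [|[|[|]]].
  have k1 : k = 1%N.
    case: k ok k_gt0 nk q D1 degL {par exc ab_ge} => [|[|[|k']]] // _ _ nk q D1 degL.
    exfalso; apply: (defect1_exclude eig x01 xh r0 bip degL R0 _ ab _ _ _ D1) => //.
    - have : (8 * k'.+3 * k'.+4 + 12 < 4 * #|L|)%N by apply: leq_trans nk cL.
      by rewrite -mulnn; move: #|L|; clear=> a; lia.
    - by lra.
    - by rewrite -nE; apply: spex_radius_ge.
  split=> //; have [v vL [[dv dL] _]] := defect1 degL D1.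
  by exists v.
(* Unequal parts already use up the whole unit, so no deficiency remains. *)
left; have lt_ab := unbalanced_product cLR n4 ab.
have lt_abR : #|L|%:R * #|~: L|%:R + 1 <= (n ^ 2 %/ 4)%:R :> R.
  by rewrite -natrM natr1 ler_nat -addn1.
have D0 : defect G k L = 0%N.
  apply/eqP; rewrite -leqn0.
  by apply: (@defect_le _ _ _ _ _ _ _ eig x01 xh r0 bip degL R0 0); lra.
split=> //; [exact: defect0 | by rewrite -par D0 |].
(* For [k = 1] the matching that leaves one vertex isolated on half of the vertices loses strictly
   less than 1, so unequal parts are not extremal. *)
move=> k1; exfalso.
have [m [nm om]] : exists m, (m + m = n)%N /\ odd m.
  by exists (n %/ 2)%N; move: n4; clear; lia.
have m4 : (4 < m)%N by move: nk nm; clear; lia.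
have [_] : 0 < r /\ m%:R ^+ 2 - 1 < r ^+ 2 - r.
  by apply: spex_lower1 nm m4 om _; move: spexG; rewrite k1.
have -> : m%:R ^+ 2 = (n ^ 2 %/ 4)%:R :> R.
  rewrite -natrX; congr (_%:R); rewrite -nm addnn -mul2n expnMn.
  by rewrite mulKn.
by move: qab; rewrite k1 mul1r; lra.
Qed.
End Spex.
End Main.

Theorem theorem1p3 (R : realType) (k : nat) (hk : (1 <= k)%N) :
  exists N : nat, forall (n : nat) (G : sgraph 'I_n),
    (N <= n)%N -> SPEX R (fan (2 * k + 3)) G ->
    exists L : {set 'I_n},
      [/\ bipartite_with_embedding G L,
          regular k (induced G L) \/ nearly_regular k (induced G L),
          subgraph_free (path_graph (2 * k + 3)) (induced G L),
          ~~ odd k -> #|L| = (n %/ 2)%N \/ #|L| = uphalf n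
        & odd k ->
          [/\ n %% 4 = 0 -> #|L| = (n %/ 2)%N,
              n %% 4 = 1 -> #|L| = ((n - 1) %/ 2)%N,
              n %% 4 = 2 -> k = 1 -> #|L| = (n %/ 2)%N,
              n %% 4 = 2 -> (3 <= k)%N ->
                #|L| = (n %/ 2 - 1)%N \/ #|L| = (n %/ 2 + 1)%N
            & n %% 4 = 3 -> #|L| = ((n + 1) %/ 2)%N]].
Proof.
exists (threshold k).+1 => n G nbig spexG.
have [nk _ _] := threshold_bounds nbig.
have [L [bip [w wL] shape]] := spex_shape hk nbig spexG.
have cLR : #|L| + #|~: L| = n by rewrite cardsC card_ord.
have pf := induced_path_free bip wL (proj1 spexG).
exists L; case: shape => [[degL ev ab_ge ab1]|[k1 exc Leq [v vL [dv dL]]]].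
  have reg : regular k (induced G L).
    by move=> v; rewrite degree_induced degL //; apply: valP.
  split=> //; first by left.
    move=> ek; move: ab_ge; rewrite /exceptional (negPf ek) addn0.
    move=> /(balanced_product cLR); move: cLR; clear; lia.
  move=> ok; rewrite oddM ok /= in ev.
  have [a2 b2] : #|L| <= #|~: L|.+2 /\ #|~: L| <= #|L|.+2.
    apply: (near_balanced_product cLR); apply: leq_trans ab_ge _.
    by rewrite -addn1 leq_add2l leq_b1.
  (* Outside the case [n = 2] modulo 4 with [k >= 3], the product is maximal and the parts differ by
     at most 1. *)
  have b1 : (n %% 4 != 2) \/ k = 1 -> #|L| <= #|~: L|.+1 /\ #|~: L| <= #|L|.+1.
    move=> H; apply: (balanced_product cLR); case: H => [n4|/ab1//].
    by move: ab_ge; rewrite /exceptional (negPf n4) andbF addn0.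
  move: (#|L|) (#|~: L|) cLR ev a2 b2 b1; clear => a b cLR ev a2 b2 b1.
  (* As [#|L|] is even, near balance leaves only the stated sizes; for [k = 1] and [n = 2] modulo 4
     it is contradictory, that case being the nearly regular one. *)
  split=> [n4|n4|n4 k1|n4 k3|n4].
  - have /b1 [h1 h2] : n %% 4 != 2 \/ k = 1 by left; rewrite n4.
    by clear -cLR ev h1 h2 n4; lia.
  - have /b1 [h1 h2] : n %% 4 != 2 \/ k = 1 by left; rewrite n4.
    by clear -cLR ev h1 h2 n4; lia.
  - have /b1 [h1 h2] : n %% 4 != 2 \/ k = 1 by right.
    by clear -cLR ev h1 h2 n4; lia.
  - by clear -cLR ev a2 b2 n4; lia.
  - have /b1 [h1 h2] : n %% 4 != 2 \/ k = 1 by left; rewrite n4.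
    by clear -cLR ev h1 h2 n4; lia.
have near : nearly_regular k (induced G L).
  exists (Sub v vL); split; first by rewrite degree_induced SubK.
  move=> u uv; rewrite degree_induced; apply: dL; first exact: valP.
  by move: uv; apply: contra => /eqP E; apply/eqP/val_inj; rewrite SubK.
move: exc; rewrite /exceptional => /andP[ok n4].
split=> //; [by right | by rewrite ok | move=> _].
by move: cLR Leq n4 k1; clear => cLR Leq n4 k1; split; lia.
Qed.
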